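(* Let $f>0$, $f\neq1$, let $\beta\in[0,1)$ and $\gamma>0$. Under $\mathbb P_0$ let $(X_i)_{i\ge1}$ be a zero-mean stationary Gaussian sequence, with possibly weak dependence (that is, the $X_i$ are independent or weakly dependent; autoregressive moving-average processes ARMA$(p,q)$ fall in this class), such that for each $m$ the covariance matrix $\Sigma_m$ of $m$ consecutive observations is positive definite. For $n\ge1$ with $n\beta$ an integer put $m=n(1-\beta)$, $\check{\boldsymbol X}=(X_{n\beta+1},\dots,X_n)$, and $$\mathscr L_{n,\beta}(\check{\boldsymbol X}):=\log\frac{\phi_{f^2\Sigma_m}(\check{\boldsymbol X})}{\phi_{\Sigma_m}(\check{\boldsymbol X})}=-m\log f+\frac12\left(1-\frac1{f^2}\right)\check{\boldsymbol X}^{\mathrm T}\Sigma_m^{-1}\check{\boldsymbol X},$$ where $\phi_{\Sigma}$ denotes the density of the centered multivariate normal distribution with covariance matrix $\Sigma$. For real $b(\beta)$ define $$\mathscr I(b(\beta)):=\sup_\theta\left(\theta b(\beta)+\theta(1-\beta)\log f+\frac{1-\beta}{2}\log\left(\frac{\theta}{f^2}+(1-\theta)\right)\right),$$ the supremum being over real $\theta$ with $\theta/f^2+1-\theta>0$. Suppose that $$b(\beta)>\lim_{n\to\infty}\frac1n\mathbb E_0\,\mathscr L_{n,\beta}(\check{\boldsymbol X}),\qquad \frac{-2}{1/f^2-1}\left(\frac{b(\beta)}{1-\beta}+\log f\right)>0.$$ Then the optimizing $\theta$ is $$-\left(\frac{\frac12(1-\beta)}{b(\beta)+(1-\beta)\log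 f}+\frac1{1/f^2-1}\right),$$ so that the requirement $\gamma=\mathscr I(b(\beta))$ becomes $$\gamma=(1-\beta)\left(-\frac12-\frac1{1/f^2-1}\left(\frac{b(\beta)}{1-\beta}+\log f\right)-\frac12\log\left(\frac{-2}{1/f^2-1}\left(\frac{b(\beta)}{1-\beta}+\log f\right)\right)\right),$$ and if $b(\beta)$ satisfies this equation, then $$\lim_{n\to\infty}\frac1n\log\mathbb P_0\left(\frac1n\mathscr L_{n,\beta}(\check{\boldsymbol X})\ge b(\beta)\right)=-\mathscr I(b(\beta))=-\gamma .$$
   Context: $\mathbb E_0$ is expectation under $\mathbb P_0$, and limits in $n$ are taken along $n$ with $n\beta$ an integer. The setting is a test for a change in scale: after observation $n\beta$ the process is replaced by a new stationary process, independent of the past, whose covariance matrix is $f^2$ times the original one, with no change in mean. The number $b(\beta)$ serves as the alarm threshold for the normalized log-likelihood ratio $\frac1n\mathscr L_{n,\beta}(\check{\boldsymbol X})$, chosen so that the decay rate of the false alarm probability equals $-\gamma$. ''Weak dependence'' is meant in the sense of a definition from the change-point literature that the source cites without reproducing. An ARMA$(p,q)$ process (here with zero mean) is a stationary process satisfying $X_i=\varepsilon_i+\sum_{j=1}^p\varrho_jX_{i-j}+\sum_{j=1}^q\vartheta_j\varepsilon_{i-j}$ with $\varepsilon_i$ i.i.d. centered normal and the roots of the autoregressive polynomial outside the unit circle. *)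

(* Defs.v *)
From HB Require Import structures.
From mathcomp Require Import all_boot all_order all_algebra.
From mathcomp Require Import all_classical all_reals all_analysis.

Set Implicit Arguments.
Unset Strict Implicit.
Unset Printing Implicit Defensive.

Import Order.TTheory GRing.Theory Num.Theory.
Import numFieldNormedType.Exports.

Local Open Scope classical_set_scope.
Local Open Scope ring_scope.

(* Sequences (X_i)_{i >= 1} are indexed from 0 here: [X i] is X_{i+1}. *)
Section process.
Context d (T : measurableType d) (R : realType) (P : probability T R).
Implicit Types X : nat -> {RV P >-> R}.

(* Strict stationarity. No decay of dependence is required here or below, so
   independent, weakly dependent and ARMA Gaussian sequences are all covered. *)
Definition stationary X : Prop :=
  forall (m h : nat) (A : set (m.-tuple R)), measurable A ->
    P [set w | A [tuple X (h + i)%N w | i < m]]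
      = P [set w | A [tuple X i w | i < m]].

(* [normal_prob mu s] is parametrized by the standard deviation and is a junk
   distribution at s = 0, hence the separate Dirac case. *)
Definition normal_law (Y : T -> R) : Prop :=
  exists mu : R,
    (forall A : set R, measurable A -> P (Y @^-1` A) = \d_mu A) \/
    (exists2 s : R, 0 < s &
       forall A : set R, measurable A -> P (Y @^-1` A) = normal_prob mu s A).

Definition gaussian_sequence X : Prop :=
  forall (m : nat) (a : 'I_m -> R),
    normal_law (fun w => \sum_(i < m) a i * X i w).

(* Sigma_m; for a stationary sequence any m consecutive observations have the
   same covariance matrix as the first m. *)
Definition cov_mx X (m : nat) : 'M[R]_m :=
  \matrix_(i, j) fine (covariance P (X i) (X j)).

End process.

Section likelihood.
Context (R : realType).

Definition quad_form (m : nat) (S : 'M[R]_m) (x : 'cV[R]_m) : R :=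
  (x^T *m S *m x) ord0 ord0.

Definition posdef_mx (m : nat) (S : 'M[R]_m) : Prop :=
  S^T = S /\ forall x : 'cV[R]_m, x != 0 -> 0 < quad_form S x.

(* phi_S, the density of the centered normal distribution on R^m *)
Definition mvn_pdf (m : nat) (S : 'M[R]_m) (x : 'cV[R]_m) : R :=
  expR (- (quad_form (invmx S) x / 2))
    / Num.sqrt ((2 * pi) ^+ m * \det S).

Definition admissible (beta : R) : set nat :=
  [set n | (0 < n)%N /\ n%:R * beta \is a Num.int].

(* For admissible n the truncation is exact: [change_pt beta n] is n beta and
   [post_size beta n] is n (1 - beta). *)
Definition change_pt (beta : R) (n : nat) : nat := Num.truncn (n%:R * beta).

Definition post_size (beta : R) (n : nat) : nat := (n - change_pt beta n)%N.

Definition log_lik (f : R) (m : nat) (S : 'M[R]_m) (x : 'cV[R]_m) : R :=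
  ln (mvn_pdf (f ^+ 2 *: S) x / mvn_pdf S x).

End likelihood.

Section statistic.
Context d (T : measurableType d) (R : realType) (P : probability T R).

(* (X_{n beta + 1}, ..., X_n) *)
Definition post_sample (X : nat -> {RV P >-> R}) (beta : R) (n : nat) (w : T)
    : 'cV[R]_(post_size beta n) :=
  \col_i X (change_pt beta n + i)%N w.

(* the random variable L_{n,beta} *)
Definition log_lik_stat (X : nat -> {RV P >-> R}) (f beta : R) (n : nat)
    (w : T) : R :=
  log_lik f (cov_mx X (post_size beta n)) (post_sample X beta n w).

End statistic.

Section rate.
Context (R : realType).

Definition rate_dom (f : R) : set R :=
  [set theta | 0 < theta / f ^+ 2 + (1 - theta)].

Definition rate_obj (f beta b theta : R) : R :=
  theta * b + theta * (1 - beta) * ln f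
    + (1 - beta) / 2 * ln (theta / f ^+ 2 + (1 - theta)).

Definition rate (f beta b : R) : \bar R :=
  ereal_sup [set (rate_obj f beta b theta)%:E | theta in rate_dom f].

Definition optimizes_rate (f beta b theta : R) : Prop :=
  rate_dom f theta /\ (rate_obj f beta b theta)%:E = rate f beta b.

End rate.

(* Main.v *)
Require Import Defs.
From HB Require Import structures.
From mathcomp Require Import all_boot all_order all_algebra.
From mathcomp Require Import all_classical all_reals all_analysis.
From mathcomp Require Import measurable_realfun ring lra.

Set Implicit Arguments.
Unset Strict Implicit.
Unset Printing Implicit Defensive.

Import Order.TTheory GRing.Theory Num.Theory.
Import numFieldNormedType.Exports.

Local Open Scope classical_set_scope.
Local Open Scope ring_scope.

(** Write m for the length of the sample x observed after the change, Sigma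
for its covariance matrix and Q = x^T Sigma^-1 x. The log-likelihood ratio is
an affine function of Q, so the alarm event is a one-sided event for Q. With
c = 1 / f^2 - 1 and u = - 2 / c * (b / (1 - beta) + ln f) it is Q >= m u when
f > 1 and Q <= m u when f < 1 ([log_lik_eventE]), and the assumption that b
exceeds the limiting mean says that u lies beyond 1 in the same direction
([mean_lt_threshold]). If B Sigma B^T = 1, then Q is the sum of the squares of
the coordinates of B x, which are jointly standard normal: Q is a chi-square
variable with m degrees of freedom. The theorem is thus the large deviation
principle for chi-square variables, whose rate is (u - 1 - ln u) / 2 per degree
of freedom, and m = n (1 - beta).

Joint normality is given through the laws of the linear combinations of the
observations. This determines directly the moment generating function
E exp (t Q / 2) = (1 - t)^(- m / 2) for every t < 1 ([chi_square_mgf]). For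
t >= 0 the identity exp (t y^2 / 2) = E exp (sqrt t * g * y), with g standard
normal, replaces the square of one coordinate by a linear term, and an exchange
of integrals reduces the claim to linear combinations. For t < 0 the same
argument works with cos instead of exp. It rests on the value of
E cos (z + y g), which solves a linear differential equation in y
([integral_cos_normal_prob]).

The moment generating function suffices for both large deviation bounds. The
upper bound ([chi_square_chernoff]) is the Markov inequality with the optimal
exponent t = 1 - 1 / u. The lower bound ([chi_square_ldp]) tilts the law of Q
so that its mean becomes m v, with v slightly beyond u, and shows that the
tilted law concentrates around m v ([chi_square_concentration]).

The formulas for the rate come from writing y = 1 + c theta: the objective
becomes (1 - beta) / 2 * (ln y - u y + u), which is strictly concave in y with
its maximum at y = 1 / u ([rate_obj_le], [rateE]). *)

(** * Gaussian integrals on the line *)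
Section normal_integrals.
Context {R : realType}.
Implicit Types m s t x y z : R.
Notation mu := (@lebesgue_measure R).

Lemma ge0_integral_normal_prob m s (h : R -> \bar R) :
  measurable_fun [set: R] h -> (forall x, 0 <= h x)%E ->
  (\int[normal_prob m s]_x h x = \int[mu]_x (h x * (normal_pdf m s x)%:E))%E.
Proof.
move=> mh h0.
have dom := normal_prob_dominates m s.
have irn := Radon_Nikodym_SigmaFinite.f_integrable dom.
rewrite -(Radon_Nikodym_SigmaFinite.change_of_variables dom)//.
apply: ae_eq_integral => //.
- by apply: emeasurable_funM => //; exact: measurable_int irn.
- apply: emeasurable_funM => //.
  by apply/measurable_EFinP; exact: measurable_normal_pdf.
- apply: ae_eqe_mul2l; apply: integral_ae_eq => //.
  + by apply/measurable_EFinP; exact: measurable_normal_pdf.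
  + move=> E _ mE.
    by rewrite -(Radon_Nikodym_SigmaFinite.f_integral dom).
Qed.

(** Multiplying a Gaussian density by an exponential of degree at most two gives
a multiple of another Gaussian density; this lemma turns such an identity
between densities into one between integrals. *)
Lemma integral_normal_prob_mul m s (k : R) (h q : R -> R) m' s' :
  measurable_fun setT h -> measurable_fun setT q ->
  (forall x, 0 <= h x) -> (forall x, 0 <= q x) -> 0 <= k ->
  (forall x, h x * normal_pdf m s x = k * normal_pdf m' s' x) ->
  (\int[normal_prob m s]_x (h x * q x)%:E
   = k%:E * \int[normal_prob m' s']_x (q x)%:E)%E.
Proof.
move=> mh mq h0 q0 k0 hE.
rewrite ge0_integral_normal_prob; last 2 first.
- by apply/measurable_EFinP; exact: measurable_funM.
- by move=> x; rewrite lee_fin mulr_ge0.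
rewrite ge0_integral_normal_prob; last 2 first.
- by apply/measurable_EFinP.
- by move=> x; rewrite lee_fin.
rewrite -ge0_integralZl//; last 2 first.
- apply/measurable_EFinP; apply: measurable_funM => //.
  exact: measurable_normal_pdf.
- by move=> x _; rewrite -EFinM lee_fin mulr_ge0// normal_pdf_ge0.
apply: eq_integral => x _; rewrite -!EFinM; congr EFin.
by rewrite mulrAC hE; ring.
Qed.

(** Completing the square: an exponential tilt translates the mean. *)
Lemma normal_pdf_expR_tilt m s t x : s != 0 ->
  expR (t * x) * normal_pdf m s x =
  expR (t * m + s ^+ 2 * t ^+ 2 / 2) * normal_pdf (m + s ^+ 2 * t) s x.
Proof.
move=> s0; rewrite !normal_pdfE// mulrCA [RHS]mulrCA; congr (_ * _).
rewrite /normal_fun -!expRD; congr expR.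
have s2 : s ^+ 2 != 0 by rewrite expf_eq0.
by field.
Qed.

Lemma integral_expR_mul_normal_prob m s t (q : R -> R) : s != 0 ->
  measurable_fun setT q -> (forall x, 0 <= q x) ->
  (\int[normal_prob m s]_x (expR (t * x) * q x)%:E
   = (expR (t * m + s ^+ 2 * t ^+ 2 / 2))%:E *
     \int[normal_prob (m + s ^+ 2 * t) s]_x (q x)%:E)%E.
Proof.
move=> s0 mq q0; apply: integral_normal_prob_mul => //.
- by apply: measurableT_comp => //; exact: measurable_funM.
- by move=> x; exact: normal_pdf_expR_tilt.
Qed.

Lemma integral_expR_normal_prob m s t : s != 0 ->
  (\int[normal_prob m s]_x (expR (t * x))%:E
   = (expR (t * m + s ^+ 2 * t ^+ 2 / 2))%:E)%E.
Proof.
move=> s0.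
under eq_integral do rewrite -[expR _]mulr1.
rewrite (@integral_expR_mul_normal_prob _ _ _ (cst 1))//= integral_cst//.
by rewrite mul1e -[X in (_ * X)%E]/(normal_prob _ _ _) probability_setT mule1.
Qed.

(** A quadratic tilt only changes the variance, as long as the coefficient of
- x^2 / 2 in the exponent, 1 / s^2 - t, stays positive. *)
Lemma normal_pdf_expR_sqr s t x : 0 < s -> t * s ^+ 2 < 1 ->
  expR (t * x ^+ 2 / 2) * normal_pdf 0 s x =
  expR (- (ln (1 - t * s ^+ 2) / 2)) *
    normal_pdf 0 (s / Num.sqrt (1 - t * s ^+ 2)) x.
Proof.
move=> s0 ts; set r := 1 - t * s ^+ 2.
have r0 : 0 < r by rewrite subr_gt0.
have sr0 : 0 < Num.sqrt r by rewrite sqrtr_gt0.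
have sr : Num.sqrt r ^+ 2 = r by rewrite sqr_sqrtr// ltW.
rewrite !normal_pdfE ?gt_eqF ?divr_gt0//.
have -> : expR (- (ln r / 2)) = (Num.sqrt r)^-1.
  rewrite expRN; congr (_^-1).
  by rewrite -[r in LHS]sr lnXn// -(mulr_natr (ln _)) mulfK// lnK.
rewrite mulrCA [RHS]mulrA; congr (_ * _).
  rewrite /normal_peak -invfM -sqrtrM; last by rewrite ltW.
  congr (_^-1); congr Num.sqrt; rewrite expr_div_n sr.
  rewrite -(mulr_natr (s ^+ 2 * _)) -(mulr_natr (_ / r * _)).
  by field; rewrite gt_eqF.
rewrite /normal_fun -expRD; congr expR.
rewrite expr_div_n sr subr0 /r.
by field; rewrite /r ?gt_eqF ?exprn_gt0.
Qed.

Lemma integral_expR_sqr_normal_prob s t : 0 < s -> t * s ^+ 2 < 1 ->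
  (\int[normal_prob 0 s]_x (expR (t * x ^+ 2 / 2))%:E
   = (expR (- (ln (1 - t * s ^+ 2) / 2)))%:E)%E.
Proof.
move=> s0 ts.
under eq_integral do rewrite -[expR _]mulr1.
rewrite (@integral_normal_prob_mul _ _ (expR (- (ln (1 - t * s ^+ 2) / 2)))
  (fun x => expR (t * x ^+ 2 / 2)) (cst 1) 0
  (s / Num.sqrt (1 - t * s ^+ 2)))//=.
- rewrite integral_cst//.
  by rewrite mul1e -[X in (_ * X)%E]/(normal_prob _ _ _) probability_setT mule1.
- apply: measurableT_comp => //; apply: measurable_funM => //.
  by apply: measurable_funM => //; exact: measurable_funX.
- by move=> x; exact: normal_pdf_expR_sqr.
Qed.

Lemma derive1_shift m : derive1 (fun x : R => x - m) = cst 1.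
Proof.
apply/funext => x; rewrite derive1E deriveB//.
by rewrite derive_id derive_cst subr0.
Qed.

Lemma ge0_integral_normal_prob_shift m s (h : R -> R) : s != 0 ->
  continuous h -> (forall x, 0 <= h x) ->
  (\int[normal_prob m s]_x (h x)%:E
   = \int[normal_prob 0 s]_x (h (x + m))%:E)%E.
Proof.
move=> s0 ch h0.
rewrite ge0_integral_normal_prob; last 2 first.
- by apply/measurable_EFinP; exact: continuous_measurable_fun.
- by move=> x; rewrite lee_fin.
rewrite ge0_integral_normal_prob; last 2 first.
- apply/measurable_EFinP; apply: (measurableT_comp (f := h)) => //.
    exact: continuous_measurable_fun.
  exact: measurable_funD.
- by move=> x; rewrite lee_fin.
rewrite (@increasing_ge0_integration_by_substitutionT _ (fun x => x - m)
  (fun x => h (x + m) * normal_pdf 0 s x)).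
- apply: eq_integral => x _; rewrite -EFinM; congr EFin.
  rewrite derive1_shift fctE/= mulr1 subrK; congr (_ * _).
  by rewrite !normal_pdfE// normal_fun_center.
- by move=> x y; rewrite ltrD2r.
- by rewrite derive1_shift => x; exact: cvg_cst.
- by rewrite derive1_shift; exact: is_cvg_cst.
- by rewrite derive1_shift; exact: is_cvg_cst.
- by move=> x; apply: derivableB.
- exact: cvg_addrr_Ny.
- exact: cvg_addrr.
- move=> x; apply: cvgM; last exact: continuous_normal_pdf.
  apply: (@continuous_comp _ _ _ (fun x => x + m) h); last exact: ch.
  by apply: cvgD; [exact: cvg_id|exact: cvg_cst].
- by move=> x; rewrite mulr_ge0// normal_pdf_ge0.
Qed.

End normal_integrals.

Section integrable_real.
Context d (T : measurableType d) (R : realType) (mu : {measure set T -> \bar R}).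

Lemma integrable_dominated (f g : T -> R) : measurable_fun [set: T] f ->
  (forall x, `|f x| <= g x) -> mu.-integrable [set: T] (EFin \o g) ->
  mu.-integrable [set: T] (EFin \o f).
Proof.
move=> mf fg ig; apply: le_integrable ig => //; first exact/measurable_EFinP.
by move=> x _ /=; rewrite lee_fin (le_trans (fg x))// ler_norm.
Qed.

Lemma ge0_integrable_EFin (f : T -> R) (c : R) : measurable_fun [set: T] f ->
  (forall x, 0 <= f x) -> (\int[mu]_x (f x)%:E = c%:E)%E ->
  mu.-integrable [set: T] (EFin \o f).
Proof.
move=> mf f0 fc; apply/integrableP; split; first exact/measurable_EFinP.
under eq_integral do rewrite /= ger0_norm//.
by rewrite fc ltry.
Qed.

Lemma Rintegral_EFin (f : T -> R) : mu.-integrable [set: T] (EFin \o f) ->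
  (\int[mu]_x (f x)%:E = (\int[mu]_x f x)%R%:E)%E.
Proof. by move=> fi; rewrite /Rintegral fineK// integrable_fin_num. Qed.

End integrable_real.

Lemma ler_norm_expR {R : realType} (x : R) : `|x| <= expR x + expR (- x).
Proof.
have e1 := expR_ge1Dx x; have e2 := expR_ge1Dx (- x).
have p1 := expR_gt0 x; have p2 := expR_gt0 (- x).
by rewrite ler_norml; apply/andP; split; lra.
Qed.

(** The right-hand side does not depend on a: it dominates the derivatives in a
of expR (a x) and is integrable for every normal law. *)
Lemma norm_mul_expR_le {R : realType} (a x : R) : `|a| <= 1 ->
  `|x| * expR (a * x) <= expR (2 * x) + expR (- 2 * x).
Proof.
move=> a1; have ax : a * x <= `|x|.
  by rewrite (le_trans (ler_norm _))// normrM ler_piMl.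
have : `|x| * expR (a * x) <= expR `|x| * expR `|x|.
  rewrite ler_pM ?expR_ge0 ?ler_expR//.
  by rewrite (le_trans _ (expR_ge1Dx _))// lerDr.
move=> /le_trans; apply; rewrite -expRD.
have [x0|x0] := leP 0 x.
- by rewrite ger0_norm// (_ : x + x = 2 * x) ?lerDl ?expR_ge0//; ring.
- by rewrite ltr0_norm// (_ : - x + - x = - 2 * x) ?lerDr ?expR_ge0//; ring.
Qed.

(** * The cosine transform of a normal law *)
Section normal_cos.
Context {R : realType} (s : R) (s_gt0 : 0 < s).
Implicit Types a x y z : R.
Notation N := (normal_prob 0 s : {measure set _ -> \bar R}).

Let s_neq0 : s != 0. Proof. by rewrite gt_eqF. Qed.

Let m_affine a y : measurable_fun [set: R] (fun x : R => a + y * x).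
Proof. by apply: measurable_funD => //; exact: measurable_funM. Qed.

Let m_cos a y : measurable_fun [set: R] (fun x : R => cos (a + y * x)).
Proof.
apply: (measurableT_comp (f := @cos R)) => //.
by apply: continuous_measurable_fun; exact: continuous_cos.
Qed.

Let m_exp a : measurable_fun [set: R] (fun x : R => expR (a * x)).
Proof. by apply: measurableT_comp => //; exact: measurable_funM. Qed.

Let i_exp a : N.-integrable [set: R] (EFin \o (fun x => expR (a * x))).
Proof.
apply: (ge0_integrable_EFin (c := expR (a * 0 + s ^+ 2 * a ^+ 2 / 2))) => //.
  exact: m_exp.
exact: integral_expR_normal_prob.
Qed.

Let i_expcos a y z :
  N.-integrable [set: R] (EFin \o (fun x => expR (a * x) * cos (z + y * x))).
Proof.
apply: integrable_dominated (i_exp a).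
  by apply: measurable_funM => //; [exact: m_exp|exact: m_cos].
move=> x; rewrite normrM ger0_norm ?expR_ge0//.
by rewrite ler_piMr ?expR_ge0 ?cos_max.
Qed.

Let i_cos y z : N.-integrable [set: R] (EFin \o (fun x => cos (z + y * x))).
Proof.
have := i_expcos 0 y z; congr (_.-integrable _ _).
by apply/funext => x /=; rewrite mul0r expR0 mul1r.
Qed.

(* The phase z makes one family stable under both derivations used below:
   a quarter turn of z exchanges sine and cosine. *)
Let C z y : R := (\int[N]_x cos (z + y * x))%R.

(** The tilt by expR (a x) moves the mean to s^2 a. The substitution that undoes
the move is available for nonnegative functions, hence 1 + cos. *)
Let int_expcos a z y :
  (\int[N]_x (expR (a * x) * cos (z + y * x)))%R
  = expR (s ^+ 2 * a ^+ 2 / 2) * C (z + y * (s ^+ 2 * a)) y.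
Proof.
have h0 x : 0 <= 1 + cos (z + y * x) by rewrite -lerBlDl sub0r cos_geN1.
have ch : continuous (fun x : R => 1 + cos (z + y * x)).
  move=> x; apply: cvgD; first exact: cvg_cst.
  apply: (@continuous_comp _ _ _ (fun x : R => z + y * x) cos).
    apply: cvgD; first exact: cvg_cst.
    by apply: cvgM; [exact: cvg_cst|exact: cvg_id].
  exact: continuous_cos.
have := @integral_expR_mul_normal_prob R 0 s a (fun x => 1 + cos (z + y * x))
  s_neq0 (continuous_measurable_fun ch) h0.
rewrite mulr0 !add0r ge0_integral_normal_prob_shift//.
have -> : (\int[N]_x (expR (a * x) * (1 + cos (z + y * x)))%:E
  = (expR (s ^+ 2 * a ^+ 2 / 2)
     + \int[N]_x (expR (a * x) * cos (z + y * x)))%R%:E)%E.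
  under eq_integral do rewrite mulrDr mulr1 EFinD.
  rewrite integralD_EFin//=.
  rewrite EFinD; congr (_ + _)%E; last exact: Rintegral_EFin (i_expcos _ _ _).
  by rewrite integral_expR_normal_prob// mulr0 add0r.
have -> : (\int[N]_x (1 + cos (z + y * (x + s ^+ 2 * a)))%:E
  = (1 + C (z + y * (s ^+ 2 * a)) y)%:E)%E.
  under eq_integral do rewrite mulrDr addrA (addrAC z) EFinD.
  rewrite integralD_EFin//=.
  - rewrite EFinD; congr (_ + _)%E; last exact: Rintegral_EFin (i_cos _ _).
    rewrite integral_cst// mul1e.
    by rewrite -[X in X = _]/(normal_prob _ _ _) probability_setT.
  - have := i_exp 0; congr (_.-integrable _ _).
    by apply/funext => x /=; rewrite mul0r expR0.
rewrite -EFinM => -[]; rewrite mulrDr mulr1 => /addrI; exact.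
Qed.

Let i_dom : N.-integrable [set: R]
  (EFin \o (fun x : R => expR (2 * x) + expR (- 2 * x))).
Proof.
rewrite (_ : _ \o _ = ((EFin \o (fun x : R => expR (2 * x))) \+
  (EFin \o (fun x : R => expR (- 2 * x))))%E)//.
by apply: integrableD => //; exact: i_exp.
Qed.

Let itv_ball (a c : R) : c \in `]a - 1, a + 1[ -> `|c - a| <= 1.
Proof.
by rewrite in_itv/= => /andP[ac ca]; rewrite ler_norml; apply/andP; split; lra.
Qed.

Let dfexp y z x a :
  is_derive a 1 (fun a => expR (a * x) * cos (z + y * x))
    (x * (expR (a * x) * cos (z + y * x))).
Proof.
by apply: is_derive_eq; rewrite /GRing.scale/=; ring.
Qed.

Let dfcos z x y :
  is_derive y 1 (fun y => cos (z + y * x)) (x * cos (z + pi / 2 + y * x)).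
Proof.
apply: is_derive_eq; rewrite addrAC cosDpihalf /GRing.scale/=; ring.
Qed.

Let derive_expcos y z : is_derive (0 : R) (1 : R)
  (fun a => (\int[N]_x (expR (a * x) * cos (z + y * x)))%R)
  (\int[N]_x (x * cos (z + y * x)))%R.
Proof.
have I0 : (`](0 - 1 : R), (0 + 1)[)%classic 0 by rewrite /= in_itv/=; lra.
have dE x a : partial1of2 (fun a x : R => expR (a * x) * cos (z + y * x)) a x
    = x * (expR (a * x) * cos (z + y * x)).
  by rewrite partial1of2E; apply: derive_val; exact: dfexp.
have G0 x : 0 <= expR (2 * x) + expR (- 2 * x) :> R.
  by rewrite addr_ge0 ?expR_ge0.
have Gub a x : (`](0 - 1 : R), (0 + 1)[)%classic a -> [set: R] x ->
    `|partial1of2 (fun a x : R => expR (a * x) * cos (z + y * x)) a x|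
    <= expR (2 * x) + expR (- 2 * x).
  move=> /itv_ball; rewrite subr0 => a1 _; rewrite dE mulrA normrM.
  rewrite (le_trans _ (norm_mul_expR_le x a1))// normrM (ger0_norm (expR_ge0 _)).
  by rewrite ler_piMr ?mulr_ge0 ?expR_ge0 ?cos_max.
have intf a : (`](0 - 1 : R), (0 + 1)[)%classic a ->
    N.-integrable [set: R]
      (EFin \o (fun a x : R => expR (a * x) * cos (z + y * x)) a).
  by move=> _; exact: (i_expcos a y z).
have derf a x : (`](0 - 1 : R), (0 + 1)[)%classic a -> [set: R] x ->
    derivable ((fun a x : R => expR (a * x) * cos (z + y * x)) ^~ x) a 1.
  by move=> _ _; have [] := dfexp y z x a.
apply: DeriveDef.
  exact: (derivable_under_integral measurableT I0 intf derf G0 i_dom Gub).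
rewrite -derive1E.
rewrite (differentiation_under_integral measurableT I0 intf derf G0 i_dom Gub).
apply: eq_Rintegral => x _; rewrite dE mul0r expR0 mul1r//.
Qed.

Let derive_cos z y :
  is_derive y 1 (C z) (\int[N]_x (x * cos (z + pi / 2 + y * x)))%R.
Proof.
have I0 : (`](y - 1 : R), (y + 1)[)%classic y by rewrite /= in_itv/=; lra.
have dE x a : partial1of2 (fun y x : R => cos (z + y * x)) a x
    = x * cos (z + pi / 2 + a * x).
  by rewrite partial1of2E; apply: derive_val; exact: dfcos.
have G0 x : 0 <= expR (2 * x) + expR (- 2 * x) :> R.
  by rewrite addr_ge0 ?expR_ge0.
have Gub a x : (`](y - 1 : R), (y + 1)[)%classic a -> [set: R] x ->
    `|partial1of2 (fun y x : R => cos (z + y * x)) a x|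
    <= expR (2 * x) + expR (- 2 * x).
  move=> _ _; rewrite dE normrM.
  have := @norm_mul_expR_le R 0 x; rewrite normr0 mul0r expR0 mulr1 => /(_ ler01).
  by apply: le_trans; rewrite ler_piMr ?cos_max.
have intf a : (`](y - 1 : R), (y + 1)[)%classic a ->
    N.-integrable [set: R] (EFin \o (fun y x : R => cos (z + y * x)) a).
  by move=> _; exact: (i_cos a z).
have derf a x : (`](y - 1 : R), (y + 1)[)%classic a -> [set: R] x ->
    derivable ((fun y x : R => cos (z + y * x)) ^~ x) a 1.
  by move=> _ _; have [] := dfcos z x a.
apply: DeriveDef.
  exact: (derivable_under_integral measurableT I0 intf derf G0 i_dom Gub).
rewrite -derive1E.
rewrite (differentiation_under_integral measurableT I0 intf derf G0 i_dom Gub).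
apply: eq_Rintegral => x _; rewrite dE//.
Qed.

Let C_phase z w y : C (z + w) y = cos w * C z y + sin w * C (z + pi / 2) y.
Proof.
rewrite /C -RintegralZl// -RintegralZl// -RintegralD//.
- apply: eq_Rintegral => x _; rewrite (addrAC z w) (addrAC z (pi / 2)).
  rewrite cosDpihalf (cosD (z + _)); ring.
- exact: (integrableZl measurableT (cos w) (i_cos y z)).
- exact: (integrableZl measurableT (sin w) (i_cos y (z + pi / 2))).
Qed.

(** Integration by parts for the normal law, obtained without boundary terms by
differentiating [int_expcos] at a = 0. *)
Let stein z y : (\int[N]_x (x * cos (z + y * x)))%R
  = s ^+ 2 * y * C (z + pi / 2) y.
Proof.
have [_ <-] := derive_expcos y z.
under eq_fun do rewrite int_expcos C_phase.
apply: derive_val.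
apply: is_derive_eq.
rewrite /GRing.scale/= !(mulr0, mul0r, expr0n, addr0, add0r, expR0, sin0, cos0).
by ring.
Qed.

(** By [stein] the derivative in y of C z is - s^2 y C z, since a half turn of
the phase changes the sign; so expR (s^2 y^2 / 2) * C z y does not depend on
y. *)
Lemma integral_cos_normal_prob z y :
  (\int[normal_prob 0 s]_x (cos (z + y * x))%:E
   = (cos z * expR (- (s ^+ 2 * y ^+ 2 / 2)))%:E)%E.
Proof.
rewrite (Rintegral_EFin (i_cos y z)) -/(C z y); congr EFin.
pose H y := expR (s ^+ 2 * y ^+ 2 / 2) * C z y.
have dH x : is_derive x 1 H 0.
  have dC := derive_cos z x; rewrite stein -addrA -splitr in dC.
  apply: is_derive_eq.
  have -> : C (z + pi) x = - C z x.
    rewrite /C -mulN1r -RintegralZl//.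
    by apply: eq_Rintegral => u _; rewrite addrAC cosDpi mulN1r.
  by rewrite /GRing.scale/= !mulr0; field.
have := is_derive_0_is_cst y 0 dH; rewrite /H.
rewrite expr0n/= mulr0 mul0r expR0 mul1r.
have -> : C z 0 = cos z.
  rewrite /C; under eq_Rintegral do rewrite mul0r addr0.
  rewrite Rintegral_cst//.
  by rewrite -[X in fine X]/(normal_prob _ _ _) probability_setT mulr1.
by move=> <-; rewrite expRN mulrAC mulfV ?mul1r// gt_eqF// expR_gt0.
Qed.

End normal_cos.

(** * The moment generating function of a sum of squares *)
Section chi_square_mgf.
Context d (T : measurableType d) (R : realType) (P : probability T R).
Notation N := (normal_prob (0 : R) 1).
Variables (m : nat) (Y : nat -> T -> R).
Hypothesis mY : forall i, measurable_fun [set: T] (Y i).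

Let m_lin (c : nat -> R) k : measurable_fun [set: T]
  (fun w => \sum_(k <= i < m) c i * Y i w).
Proof. by apply: measurable_sum => i; exact: measurable_funM. Qed.

Let m_gauss (r : R) k : measurable_fun [set: T]
  (fun w => expR (r * \sum_(0 <= i < k) Y i w ^+ 2)).
Proof.
apply: measurableT_comp => //; apply: measurable_funM => //.
by apply: measurable_sum => i; exact: measurable_funX.
Qed.

(* The pair (e, kappa) stands for (exp, 1) or (cos, - 1). In both cases the
   average of e (z + y g) over a standard normal g is e z exp (kappa y^2 / 2). *)
Section linearization.
Variables (e : R -> R) (kappa s : R).
Hypothesis me : measurable_fun [set: R] e.
Hypothesis e0 : e 0 = 1.
Hypothesis e_bound :
  (forall x, 0 <= e x) \/ (kappa <= 0 /\ forall x, `|e x| <= 1).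
Hypothesis eN : forall z y,
  (\int[N]_g (e (z + y * g))%:E = (e z * expR (kappa * y ^+ 2 / 2))%:E)%E.
Hypothesis eY : forall c : nat -> R,
  (\int[P]_w (e (\sum_(0 <= i < m) c i * Y i w))%:E
   = (expR (kappa / 2 * \sum_(0 <= i < m) c i ^+ 2))%:E)%E.
Hypotheses (s_ge0 : 0 <= s) (s_lt1 : kappa * s < 1).

(* The integrand at step k: the first k squares are in the exponential, the
   k-th one is linearized by the auxiliary normal variable u.2. *)
Let F (c : nat -> R) k (u : T * R) : R :=
  expR (kappa * s / 2 * \sum_(0 <= i < k) Y i u.1 ^+ 2) *
  e (\sum_(k.+1 <= i < m) c i * Y i u.1 + Num.sqrt s * Y k u.1 * u.2).

Let mF c k : measurable_fun [set: T * R] (F c k).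
Proof.
apply: measurable_funM.
  exact: (measurableT_comp (m_gauss (kappa * s / 2) k) measurable_fst).
apply: measurableT_comp => //; apply: measurable_funD.
  exact: (measurableT_comp (m_lin c k.+1) measurable_fst).
apply: measurable_funM; last exact: measurable_snd.
apply: measurable_funM => //.
exact: (measurableT_comp (mY k) measurable_fst).
Qed.

Let mFE c k : measurable_fun [set: T * R] (EFin \o F c k).
Proof. by apply/measurable_EFinP; exact: mF. Qed.

Let i_eN z y :
  (N : {measure set _ -> \bar R}).-integrable [set: R]
    (EFin \o (fun g => e (z + y * g))).
Proof.
have m_aff : measurable_fun [set: R] (fun g : R => z + y * g).
  by apply: measurable_funD => //; exact: measurable_funM.
have m_e : measurable_fun [set: R] (fun g => e (z + y * g)).
  exact: (measurableT_comp me m_aff).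
have [e_ge0|[k0 e_le1]] := e_bound.
  by apply: (ge0_integrable_EFin (c := e z * expR (kappa * y ^+ 2 / 2))).
apply: (integrable_dominated (g := cst 1)) => //.
exact: finite_measure_integrable_cst.
Qed.

Let mF2 c k w : measurable_fun [set: R] (fun g => F c k (w, g)).
Proof. exact: (measurableT_comp (mF c k) (measurable_pair1 w)). Qed.

Let swap c k : (\int[P]_w \int[N]_g (F c k (w, g))%:E
  = \int[N]_g \int[P]_w (F c k (w, g))%:E)%E.
Proof.
have [e_ge0|[k0 e_le1]] := e_bound.
  apply: (@fubini_tonelli _ _ _ _ _ P N (EFin \o F c k)).
    by apply/measurable_EFinP; exact: mF.
  by move=> u; rewrite lee_fin mulr_ge0 ?expR_ge0.
apply: (@Fubini _ _ _ _ _ P N (EFin \o F c k)).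
apply/integrable12ltyP; first by apply/measurable_EFinP; exact: mF.
apply: (@le_lt_trans _ _ (\int[P]_w \int[N]_g 1)%E); last first.
  have N1 : (\int[N]_g 1 = 1 :> \bar R)%E.
    rewrite integral_cst// mul1e.
    exact: (@probability_setT _ _ _ (N : probability _ _)).
  under eq_integral do rewrite N1.
  by rewrite integral_cst//= probability_setT mule1 ltry.
apply: ge0_le_integral => //.
- by move=> w _; exact: integral_ge0.
- apply: (@measurable_fun_fubini_tonelli_F _ _ _ _ _ N (abse \o (EFin \o F c k))).
    exact: (measurableT_comp (f := abse) _ (mFE c k)).
  by move=> u; exact: abse_ge0.
- move=> w _; apply: ge0_le_integral => //.
  + apply: (measurableT_comp (f := abse)) => //.
    by apply/measurable_EFinP; exact: mF2.
  + move=> g _; rewrite /= lee_fin normrM ger0_norm ?expR_ge0//.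
    rewrite mulr_ile1 ?expR_ge0// -expR0 ler_expR mulr_le0_ge0//.
      by rewrite mulr_le0_ge0// mulr_le0_ge0.
    by apply: sumr_ge0 => i _; exact: sqr_ge0.
Qed.

(** Induction on the number k of squares. The last square is written as a
Gaussian average of e at a linear term; after the exchange of integrals the
induction hypothesis applies, with sqrt s * g as k-th coefficient, and a
Gaussian integral in g remains. *)
Lemma integral_partial_gauss k (c : nat -> R) : (k <= m)%N ->
  (\int[P]_w (expR (kappa * s / 2 * \sum_(0 <= i < k) Y i w ^+ 2) *
              e (\sum_(k <= i < m) c i * Y i w))%:E
   = (expR (- (k%:R / 2 * ln (1 - kappa * s))) *
      expR (kappa / 2 * \sum_(k <= i < m) c i ^+ 2))%:E)%E.
Proof.
elim: k c => [|k IH] c km.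
  rewrite !mul0r oppr0 expR0 mul1r -eY.
  by apply: eq_integral => w _; rewrite big_geq// mulr0 expR0 mul1r.
transitivity (\int[P]_w \int[N]_g (F c k (w, g))%:E)%E.
  apply: eq_integral => w _; rewrite /F/=.
  under eq_integral do rewrite EFinM.
  rewrite integralZl//; last exact: i_eN.
  rewrite eN -EFinM; congr EFin; rewrite big_nat_recr//= mulrDr expRD.
  rewrite -mulrA [X in _ = _ * X]mulrC; congr (_ * (expR _ * _)).
  by rewrite exprMn sqr_sqrtr//; ring.
rewrite swap.
pose c' g i := if i == k then Num.sqrt s * g else c i.
transitivity (\int[N]_g
  ((expR (- (k%:R / 2 * ln (1 - kappa * s))) *
    expR (kappa / 2 * \sum_(k.+1 <= i < m) c i ^+ 2))%:E *
   (expR (kappa * s * g ^+ 2 / 2))%:E))%E.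
  apply: eq_integral => g _.
  have sum_c' (f : R -> nat -> R) : \sum_(k <= i < m) f (c' g i) i =
      f (Num.sqrt s * g) k + \sum_(k.+1 <= i < m) f (c i) i.
    rewrite big_ltn// /c' eqxx; congr (_ + _); apply: eq_big_nat => i /andP[ki _].
    by rewrite gtn_eqF.
  have := IH (c' g) (ltnW km).
  rewrite (sum_c' (fun x _ => x ^+ 2)) => IHg.
  transitivity (expR (- (k%:R / 2 * ln (1 - kappa * s))) *
    expR (kappa / 2 * ((Num.sqrt s * g) ^+ 2 + \sum_(k.+1 <= i < m) c i ^+ 2)))%:E.
    rewrite -IHg; apply: eq_integral => w _.
    rewrite /F/= (sum_c' (fun x i => x * Y i w)) addrC.
    by rewrite (mulrAC (Num.sqrt s)).
  rewrite -EFinM; congr EFin; rewrite -[RHS]mulrA; congr (_ * _).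
  rewrite -expRD; congr expR.
  by rewrite exprMn sqr_sqrtr//; ring.
rewrite ge0_integralZl_EFin//; last first.
- apply/measurable_EFinP; apply: measurableT_comp => //.
  by apply: measurable_funM => //; exact: measurable_funM.
rewrite integral_expR_sqr_normal_prob ?expr1n ?mulr1//.
rewrite -EFinM; congr EFin; rewrite [LHS]mulrAC; congr (_ * _).
rewrite -expRD; congr expR.
by rewrite -natr1; field.
Qed.

Lemma integral_expR_sqr_norm :
  (\int[P]_w (expR (kappa * s / 2 * \sum_(0 <= i < m) Y i w ^+ 2))%:E
   = (expR (- (m%:R / 2 * ln (1 - kappa * s))))%:E)%E.
Proof.
have := integral_partial_gauss (fun=> 0) (leqnn m).
rewrite big_geq// mulr0 expR0 mulr1 => <-.
by apply: eq_integral => w _; rewrite [X in e X]big_geq// e0 mulr1.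
Qed.

End linearization.

(** Positive t needs exp, which is nonnegative, negative t needs cos, which is
bounded; these are the two situations in which the integrals commute. *)
Lemma chi_square_mgf (t : R) : t < 1 ->
  (forall c : nat -> R,
    (\int[P]_w (expR (\sum_(0 <= i < m) c i * Y i w))%:E
     = (expR ((\sum_(0 <= i < m) c i ^+ 2) / 2))%:E)%E) ->
  (forall c : nat -> R,
    (\int[P]_w (cos (\sum_(0 <= i < m) c i * Y i w))%:E
     = (expR (- ((\sum_(0 <= i < m) c i ^+ 2) / 2)))%:E)%E) ->
  (\int[P]_w (expR (t / 2 * \sum_(0 <= i < m) Y i w ^+ 2))%:E
   = (expR (- (m%:R / 2 * ln (1 - t))))%:E)%E.
Proof.
move=> t1 expY cosY; have [t0|t0] := leP 0 t.
- have := @integral_expR_sqr_norm expR 1 t; rewrite (mul1r t); apply => //.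
  + exact: expR0.
  + by left => x; exact: expR_ge0.
  + move=> z y; under eq_integral do rewrite expRD EFinM.
    rewrite ge0_integralZl_EFin//; first last.
    * by apply/measurable_EFinP; apply: measurableT_comp.
    rewrite integral_expR_normal_prob// -EFinM; congr (_ * expR _)%:E.
    by rewrite mulr0 add0r expr1n.
  + by move=> c; rewrite expY mulrC mul1r.
- have := @integral_expR_sqr_norm cos (- 1) (- t).
  rewrite mulrNN (mul1r t); apply => //.
  + by apply: continuous_measurable_fun; exact: continuous_cos.
  + exact: cos0.
  + by right; split; [rewrite oppr_le0|exact: cos_max].
  + move=> z y; rewrite integral_cos_normal_prob//; congr (_ * expR _)%:E.
    by rewrite expr1n; ring.
  + by move=> c; rewrite cosY; congr (expR _)%:E; ring.
  + by rewrite oppr_ge0 ltW.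
Qed.

End chi_square_mgf.

(** * Large deviations from the moment generating function *)

(** The Legendre transform at u of t |-> - ln (1 - t), halved, in the
normalization E exp (t Q / 2) of the moment generating function. *)
Definition chi_square_rate {R : realType} (u : R) : R := (u - 1 - ln u) / 2.

(** ln z <= z - 1 at z = 1 / (1 + x). *)
Lemma ln1D_ge {R : realType} (x : R) : - 2^-1 <= x -> x - 2 * x ^+ 2 <= ln (1 + x).
Proof.
move=> x2; have x1 : 0 < 1 + x by lra.
have : ln (1 + x)^-1 <= - x / (1 + x).
  rewrite [X in ln X](_ : _ = 1 + - x / (1 + x)); last by field; rewrite gt_eqF.
  by apply: le_ln1Dx; rewrite ltr_pdivlMr//; lra.
rewrite lnV ?posrE// => lnx.
suff : x - 2 * x ^+ 2 <= x / (1 + x) by rewrite mulNr in lnx; lra.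
rewrite ler_pdivlMr//.
have -> : (x - 2 * x ^+ 2) * (1 + x) = x - x ^+ 2 * (1 + 2 * x) by ring.
by rewrite lerBlDr lerDl mulr_ge0 ?sqr_ge0//; lra.
Qed.

Lemma measurable_set_ler d (T : measurableType d) (R : realType) (f g : T -> R) :
  measurable_fun [set: T] f -> measurable_fun [set: T] g ->
  measurable [set w | f w <= g w].
Proof.
move=> mf mg; have := measurable_fun_ler mf mg measurableT (Y := [set true]) I.
by rewrite setTI preimage_true.
Qed.

Section chi_square_large_deviation.
Context d (T : measurableType d) (R : realType) (P : probability T R).

Definition has_chi_square_mgf (m : nat) (Q : T -> R) := forall t : R, t < 1 ->
  (\int[P]_w (expR (t / 2 * Q w))%:E = (expR (- (m%:R / 2 * ln (1 - t))))%:E)%E.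

Section fixed_degree.
Variables (m : nat) (Q : T -> R).
Hypothesis mQ : measurable_fun [set: T] Q.
Hypothesis mgfQ : has_chi_square_mgf m Q.

Let m_exp (a b : R) : measurable_fun [set: T] (fun w => expR (a * Q w + b)).
Proof.
by apply: measurableT_comp => //; apply: measurable_funD => //; exact: measurable_funM.
Qed.

Let integral_exp (t b : R) : t < 1 ->
  (\int[P]_w (expR (t / 2 * Q w + b))%:E
   = (expR (b - m%:R / 2 * ln (1 - t)))%:E)%E.
Proof.
move=> t1; under eq_integral do rewrite addrC expRD EFinM.
rewrite ge0_integralZl_EFin//; last first.
  apply/measurable_EFinP; apply: measurableT_comp => //; exact: measurable_funM.
by rewrite mgfQ// -EFinM -expRD.
Qed.

(** The factor u - 1 selects the tail: the event is Q >= m u for u > 1 and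
Q <= m u for u < 1. In both cases exp (t (Q - m u) / 2) >= 1 there with
t = 1 - 1 / u, which has the sign of u - 1. *)
Lemma chi_square_chernoff (u : R) : 0 < u ->
  (P [set w | 0 <= (u - 1) * (Q w - m%:R * u)]%R
   <= (expR (- (m%:R * chi_square_rate u)))%:E)%E.
Proof.
move=> u0; set A := [set w | _].
have mA : measurable A.
  apply: measurable_set_ler => //.
  by apply: measurable_funM => //; exact: measurable_funB.
pose t := 1 - u^-1.
have t1 : t < 1 by rewrite /t gtrBl invr_gt0.
rewrite -(setIT A) -integral_indic//.
apply: (@le_trans _ _
  (\int[P]_w (expR (t / 2 * Q w + - (t / 2 * (m%:R * u))))%:E)%E).
  apply: ge0_le_integral => //.
  - by apply/measurable_EFinP.
  - by apply/measurable_EFinP.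
  move=> w _; rewrite lee_fin indicE.
  case: (boolP (w \in A)) => [|_]; last exact: expR_ge0.
  rewrite inE /A/= => wA; rewrite -[leLHS]/(1 : R) -[leLHS]expR0 ler_expR.
  have -> : t / 2 * Q w + - (t / 2 * (m%:R * u)) =
      (u - 1) * (Q w - m%:R * u) / (2 * u).
    by rewrite /t; field; rewrite gt_eqF.
  by rewrite divr_ge0// mulr_ge0// ltW.
rewrite integral_exp// lee_fin ler_expR /chi_square_rate.
have -> : 1 - t = u^-1 by rewrite /t; ring.
rewrite lnV ?posrE//.
rewrite le_eqVlt; apply/orP; left; apply/eqP; rewrite /t.
by field; rewrite gt_eqF.
Qed.

(** Put q = Q - m v and r = 1 - 1 / v, the tilt that gives Q the mean m v. On
the event |q| <= m e the weight exp (r q / 2) is at most exp (|r| m e / 2), and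
off the event 1 is at most exp (t (q - m e) / 2) or exp (- t (q + m e) / 2).
Hence, everywhere,
exp (- |r| m e / 2) * exp (r q / 2) * (1 - both of these) <= 1_{|q| <= m e},
and the expectation of the left-hand side is explicit. The second-order bound
[ln1D_ge] and t = e / (4 v^2), which minimizes the resulting quadratic in t,
make the two error terms exponentially small in m. *)
Lemma chi_square_concentration (v e : R) : 0 < v -> 0 < e -> e <= v ->
  expR (- (m%:R * (chi_square_rate v + `|1 - v^-1| * e / 2))) *
    (1 - 2 * expR (- (m%:R * (e ^+ 2 / (16 * v ^+ 2)))))
  <= fine (P [set w | `|Q w - m%:R * v| <= m%:R * e]).
Proof.
move=> v0 e0 ev; set A := [set w | _].
have vn0 : v != 0 by rewrite gt_eqF.
have mA : measurable A.
  apply: measurable_set_ler => //.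
  by apply: measurableT_comp => //; exact: measurable_funB.
have PA : P A = (fine (P A))%:E by rewrite fineK// fin_num_measure.
pose r := 1 - v^-1; pose t := e / (4 * v ^+ 2).
pose C := expR (- (`|r| * (m%:R * e) / 2)).
(* k = 0 is the main term, k = 1 and k = - 1 are the two error terms. *)
pose D k w := expR ((r + k * t) / 2 * Q w +
  - ((r + k * t) / 2 * (m%:R * v) + `|k| * t / 2 * (m%:R * e))).
have tv : t * v <= 4^-1.
  have -> : t * v = 4^-1 * (e / v) by rewrite /t; field.
  by rewrite ler_piMr// ler_pdivrMr// mul1r.
have t0 : 0 < t by rewrite divr_gt0// mulr_gt0// exprn_gt0.
have tv0 : 0 < t * v by exact: mulr_gt0.
have Dint k : `|k| <= 1 -> (\int[P]_w (D k w)%:E <=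
   (expR (- (m%:R * (chi_square_rate v + `|k| * (t * e / 2)
                     - k ^+ 2 * (t * v) ^+ 2))))%:E)%E.
  move=> k1.
  have ktv : `|k * (t * v)| <= 4^-1.
    by rewrite normrM (gtr0_norm tv0) (le_trans _ tv)// ler_piMl// ltW.
  have [ktv1 ktv2] : k * (t * v) <= 4^-1 /\ - 4^-1 <= k * (t * v).
    by move: ktv; rewrite ler_norml => /andP[].
  have vE : 1 - (r + k * t) = (1 + - (k * (t * v))) / v by rewrite /r; field.
  have k0 : 0 < 1 + - (k * (t * v)) by lra.
  rewrite /D integral_exp; last by rewrite -subr_gt0 vE divr_gt0.
  rewrite lee_fin ler_expR vE ln_div ?posrE//.
  have lb : - (k * (t * v)) - 2 * (- (k * (t * v))) ^+ 2
      <= ln (1 + - (k * (t * v))).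
    by apply: ln1D_ge; lra.
  have m2 : 0 <= m%:R / 2 :> R by rewrite divr_ge0 ?ler0n.
  have {lb} := ler_wpM2l m2 lb.
  have rv : r * v = v - 1 by rewrite /r; field.
  rewrite /chi_square_rate -rv; set L := ln _ => lb.
  nra.
have mD k : measurable_fun [set: T] (D k) by exact: m_exp.
have D0 k w : 0 <= D k w by exact: expR_ge0.
have C0 : 0 <= C by exact: expR_ge0.
have D0int : (\int[P]_w (D 0 w)%:E = (expR (- (m%:R * chi_square_rate v)))%:E)%E.
  rewrite /D integral_exp mul0r addr0; last by rewrite gtrBl invr_gt0.
  rewrite normr0 !mul0r addr0 (_ : 1 - r = v^-1); last by rewrite /r; ring.
  rewrite lnV ?posrE// /chi_square_rate; congr (expR _)%:E.
  by rewrite /r; field.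
have pointwise w : C * D 0 w <= \1_A w + C * D 1 w + C * D (- 1) w.
  have CD k : 0 <= C * D k w by rewrite mulr_ge0.
  rewrite indicE; case: (boolP (w \in A)) => [|/negP].
    rewrite inE /A/= => wA.
    suff : C * D 0 w <= 1.
      move=> h; have h1 := CD 1; have h2 := CD (- 1).
      by rewrite (_ : true%:R = 1)//; lra.
    rewrite /C /D -expRD -[leRHS]expR0 ler_expR mul0r addr0 normr0 !mul0r addr0.
    have h : r * (Q w - m%:R * v) <= `|r| * (m%:R * e).
      by rewrite (le_trans (ler_norm _))// normrM ler_wpM2l.
    lra.
  rewrite inE /A/= => /negP; rewrite -ltNge lter_normr => /orP[qe|qe].
  - suff : D 0 w <= D 1 w.
      move=> /(ler_wpM2l C0) h; have h1 := CD (- 1).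
      by rewrite (_ : false%:R = 0)//; lra.
    rewrite /D ler_expR normr0 normr1 !mul0r !mul1r.
    have h : 0 < t * (Q w - m%:R * v - m%:R * e) by rewrite mulr_gt0// subr_gt0.
    lra.
  - suff : D 0 w <= D (- 1) w.
      move=> /(ler_wpM2l C0) h; have h1 := CD 1.
      by rewrite (_ : false%:R = 0)//; lra.
    rewrite /D ler_expR normr0 normrN1 !mul0r !mul1r !mulN1r.
    have h : 0 < t * (- (Q w - m%:R * v) - m%:R * e) by rewrite mulr_gt0// subr_gt0.
    lra.
have mCD k : measurable_fun [set: T] (fun w => (C * D k w)%:E).
  by apply/measurable_EFinP; exact: measurable_funM.
have CDint k : (\int[P]_w (C * D k w)%:E = C%:E * \int[P]_w (D k w)%:E)%E.
  under eq_integral do rewrite EFinM.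
  rewrite ge0_integralZl_EFin//; first by move=> w _; rewrite lee_fin.
  by apply/measurable_EFinP; exact: mD.
have : (\int[P]_w (C * D 0 w)%:E <=
    \int[P]_w ((\1_A w)%:E + (C * D 1 w)%:E + (C * D (- 1) w)%:E))%E.
  apply: ge0_le_integral => //.
  - by move=> w _; rewrite lee_fin mulr_ge0.
  - apply: emeasurable_funD; last exact: mCD.
    apply: emeasurable_funD; last exact: mCD.
    by apply/measurable_EFinP.
  - by move=> w _; rewrite -!EFinD lee_fin.
rewrite ge0_integralD//; last 3 first.
- by move=> w _; rewrite -EFinD lee_fin addr_ge0// mulr_ge0.
- apply: emeasurable_funD; last exact: mCD.
  by apply/measurable_EFinP.
- by move=> w _; rewrite lee_fin mulr_ge0.
rewrite ge0_integralD//; last 2 first.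
- by apply/measurable_EFinP.
- by move=> w _; rewrite lee_fin mulr_ge0.
have intA : (\int[P]_w (\1_A w)%:E = (fine (P A))%:E)%E.
  by rewrite integral_indic// setIT; exact: PA.
rewrite intA !CDint D0int => le1.
pose E := expR (- (m%:R * (chi_square_rate v + e ^+ 2 / (16 * v ^+ 2)))).
have DE k : `|k| = 1 -> (C%:E * \int[P]_w (D k w)%:E <= (C * E)%:E)%E.
  move=> k1; have k2 : k ^+ 2 = 1 by rewrite -(real_normK (num_real k)) k1 expr1n.
  rewrite EFinM lee_wpmul2l ?lee_fin//.
  apply: (le_trans (Dint k _)); first by rewrite k1.
  rewrite lee_fin ler_expR lerN2 ler_wpM2l// -addrA lerD2l k1 k2.
  by rewrite /t le_eqVlt; apply/orP; left; apply/eqP; field.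
have := le_trans le1 (leeD (leeD (lexx _) (DE 1 (normr1 _))) (DE (- 1) (normrN1 _))).
rewrite -EFinM -!EFinD lee_fin => {}le1.
have -> : expR (- (m%:R * (chi_square_rate v + `|1 - v^-1| * e / 2)))
    = C * expR (- (m%:R * chi_square_rate v)).
  by rewrite /C -expRD; congr expR; rewrite -/r; ring.
have EE : E = expR (- (m%:R * chi_square_rate v)) *
    expR (- (m%:R * (e ^+ 2 / (16 * v ^+ 2)))).
  by rewrite /E mulrDr opprD expRD.
rewrite EE in le1; nra.
Qed.

End fixed_degree.

(** Apply [chi_square_concentration] to an interval of half-width e m centred at
m v, where v is at distance e from u on the side away from 1: the interval lies
in the tail event and its cost tends to that of u as e tends to 0. *)
Lemma chi_square_ldp (u eps : R) : 0 < u -> 0 < eps ->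
  exists M : R, forall (m : nat) (Q : T -> R), M <= m%:R ->
    measurable_fun [set: T] Q -> has_chi_square_mgf m Q ->
    expR (- (m%:R * (chi_square_rate u + eps)))
    <= fine (P [set w | 0 <= (u - 1) * (Q w - m%:R * u)]).
Proof.
move=> u0 eps0.
(* e <= u / 2 keeps v >= u / 2, so that e <= v and 1 / v <= 2 / u; the other
   bound makes the loss at most e (1 + 1 / v) <= eps / 2. *)
pose e := Num.min (u / 2) (eps / 2 / (1 + 2 / u)).
have u2 : 0 < 1 + 2 / u by rewrite addr_gt0// divr_gt0.
have e0 : 0 < e by rewrite lt_min !divr_gt0.
have eu : e <= u / 2 by rewrite ge_min lexx.
have ee : e * (1 + 2 / u) <= eps / 2.
  by rewrite -ler_pdivlMr// ge_min lexx orbT.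
pose v := if 1 <= u then u + e else u - e.
have vu : `|v - u| = e.
  rewrite /v; case: ifP => _.
    by rewrite addrAC subrr add0r gtr0_norm.
  by rewrite addrAC subrr add0r normrN gtr0_norm.
have vu2 : u / 2 <= v by rewrite /v; case: ifP => _; lra.
have v0 : 0 < v by lra.
have ev : e <= v by lra.
have vV : v^-1 <= 2 / u.
  by rewrite -[leRHS]invrK lef_pV2 ?posrE ?invr_gt0 ?divr_gt0// invf_div.
have rate_v : chi_square_rate v + `|1 - v^-1| * e / 2
    <= chi_square_rate u + eps / 2.
  have lnuv : ln u - ln v <= e * v^-1.
    rewrite -ln_div ?posrE//.
    have -> : u / v = 1 + (u - v) / v by field; rewrite gt_eqF.
    apply: (le_trans (le_ln1Dx _)).
      by rewrite ltr_pdivlMr//; lra.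
    apply: ler_wpM2r; first by rewrite invr_ge0 ltW.
    by rewrite -vu distrC ler_norm.
  have n1 : `|1 - v^-1| <= 1 + v^-1.
    by rewrite (le_trans (ler_normB _ _))// normr1 gtr0_norm ?invr_gt0.
  have vue : v - u <= e by rewrite -vu ler_norm.
  have h1 := ler_wpM2r (ltW e0) n1.
  have h2 := ler_wpM2l (ltW e0) vV.
  rewrite /chi_square_rate; nra.
pose k := e ^+ 2 / (16 * v ^+ 2).
have k0 : 0 < k by rewrite divr_gt0 ?exprn_gt0// mulr_gt0// exprn_gt0.
(* These thresholds give exp (- m k) <= 1 / 4 and exp (- m eps / 2) <= 1 / 2, so
   the factor 1 - 2 exp (- m k) costs at most exp (- m eps / 2). *)
exists (Num.max (3 / k) (2 / eps)) => m Q; rewrite ge_max => /andP[mk me] mQ mgfQ.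
have [mk3 me1] : 3 <= m%:R * k /\ 1 <= m%:R * (eps / 2).
  by split; [rewrite -ler_pdivrMr|rewrite mulrA ler_pdivlMr// mul1r -ler_pdivrMr].
apply: le_trans (_ : fine (P [set w | `|Q w - m%:R * v| <= m%:R * e]) <= _); last first.
  apply: fine_le.
  - rewrite fin_num_measure//; apply: measurable_set_ler => //.
    by apply: measurableT_comp => //; exact: measurable_funB.
  - rewrite fin_num_measure//; apply: measurable_set_ler => //.
    by apply: measurable_funM => //; exact: measurable_funB.
  apply: le_measure; rewrite ?inE.
  - apply: measurable_set_ler => //.
    by apply: measurableT_comp => //; exact: measurable_funB.
  - apply: measurable_set_ler => //.
    by apply: measurable_funM => //; exact: measurable_funB.
  move=> w /=; rewrite ler_norml => /andP[Q1 Q2].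
  move: Q1 Q2; rewrite /v; case: ifPn => [u1|]; last rewrite -ltNge => u1.
  - move=> Q1 _; rewrite mulr_ge0 ?subr_ge0//; lra.
  - by move=> _ Q2; apply: mulr_le0; rewrite subr_le0; [exact: ltW|lra].
apply: le_trans (chi_square_concentration mQ mgfQ v0 e0 ev).
rewrite -/k.
have half : expR (- (m%:R * (eps / 2))) <= 1 - 2 * expR (- (m%:R * k)).
  have h1 : expR (- (m%:R * (eps / 2))) <= 2^-1.
    rewrite expRN lef_pV2 ?posrE ?expR_gt0//.
    by rewrite (le_trans _ (expR_ge1Dx _))//; lra.
  have h2 : expR (- (m%:R * k)) <= 4^-1.
    rewrite expRN lef_pV2 ?posrE ?expR_gt0//.
    by rewrite (le_trans _ (expR_ge1Dx _))//; lra.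
  lra.
apply: le_trans (_ : expR (- (m%:R * (chi_square_rate u + eps / 2))) *
  expR (- (m%:R * (eps / 2))) <= _).
  by rewrite -expRD ler_expR le_eqVlt; apply/orP; left; apply/eqP; field.
apply: ler_pM => //; rewrite ?expR_ge0// ler_expR lerN2.
by rewrite ler_wpM2l.
Qed.

End chi_square_large_deviation.

(** * Whitening a positive definite matrix *)
Section posdef_matrices.
Context {R : realType}.

(** Induction on the size: eliminating the first row and column leaves the Schur
complement, which is again positive definite. *)
Lemma posdef_congr (m : nat) (S : 'M[R]_m) : posdef_mx S ->
  exists B : 'M[R]_m, B *m S *m B^T = 1%:M.
Proof.
elim: m S => [|m IH] S [symS posS].
  by exists 0; rewrite [LHS]flatmx0 [RHS]flatmx0.
change 'M[R]_(1 + m) in S.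
change (forall x : 'cV[R]_(1 + m), x != 0 -> 0 < quad_form S x) in posS.
pose a := ulsubmx S 0 0; pose r := ursubmx S; pose D := drsubmx S.
have SE : S = block_mx a%:M r r^T D.
  by rewrite -[LHS]submxK -mx11_scalar /r trmx_ursub symS.
have a0 : 0 < a.
  have := posS (col_mx 1%:M 0); rewrite /quad_form SE.
  rewrite tr_col_mx mul_row_block mul_row_col trmx0 !mulmx0 !mul0mx !addr0 trmx1.
  rewrite mul1mx mulmx1 mxE eqxx mulr1n; apply.
  apply/eqP => /(congr1 usubmx); rewrite col_mxKu => /matrixP/(_ 0 0).
  by rewrite !mxE eqxx => /eqP; rewrite oner_eq0.
pose k := (Num.sqrt a)^-1.
have kak : k * a * k = 1.
  rewrite /k -[X in _ * X * _](sqr_sqrtr (ltW a0)).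
  by field; rewrite gt_eqF// sqrtr_gt0.
pose L : 'M[R]_(1 + m) := block_mx k%:M 0 (- a^-1 *: r^T) 1%:M.
pose D' := D - a^-1 *: (r^T *m r).
have LSL : L *m S *m L^T = block_mx 1%:M 0 0 D'.
  rewrite SE /L tr_block_mx !mulmx_block.
  rewrite !(mul0mx, mulmx0, mul1mx, mulmx1, trmx0, trmx1, addr0, add0r).
  rewrite tr_scalar_mx.
  rewrite !linearZ/= trmxK.
  rewrite !(mul_scalar_mx, mul_mx_scalar, scalerA, scalemxAl, mulNr).
  have a_neq0 : a != 0 by rewrite gt_eqF.
  have ma : a * - a^-1 = - 1 by rewrite mulrN divff.
  rewrite ma !scaleN1r mulNmx mul_scalar_mx !addNr !scaler0 mul0mx add0r.
  rewrite scale_scalar_mx (mulrC a) kak.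
  by rewrite -scalemxAl scaleNr addrC.
have [B' B'D] : exists B' : 'M[R]_m, B' *m D' *m B'^T = 1%:M.
  apply: IH; split.
    rewrite /D' linearB linearZ/= trmx_mul trmxK; congr (_ - _).
    by rewrite /D trmx_drsub symS.
  move=> y y0; have := posS (L^T *m col_mx 0 y).
  have -> : quad_form S (L^T *m col_mx 0 y) = quad_form D' y.
    rewrite /quad_form trmx_mul trmxK -!mulmxA (mulmxA S) (mulmxA L) (mulmxA L) LSL.
    rewrite tr_col_mx trmx0 mul_block_col mul_row_col.
    by rewrite !(mul0mx, mulmx0, add0r, mulmxA).
  apply.
  rewrite /L tr_block_mx mul_block_col trmx0 trmx1 mul1mx !mul0mx add0r.
  apply: contra_neq y0 => /(congr1 dsubmx); rewrite col_mxKd => ->.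
  by apply/matrixP => i j; rewrite !mxE.
pose B : 'M[R]_(1 + m) := block_mx 1%:M 0 0 B' *m L.
suff : B *m S *m B^T = 1%:M by exists B.
rewrite /B.
rewrite trmx_mul -!mulmxA (mulmxA S) (mulmxA L) (mulmxA L) LSL.
rewrite tr_block_mx !mulmx_block.
rewrite !(trmx0, trmx1, mul0mx, mulmx0, mul1mx, mulmx1, addr0, add0r).
by rewrite mulmxA B'D -scalar_mx_block.
Qed.

Lemma invmx_congr (m : nat) (S B : 'M[R]_m) : B *m S *m B^T = 1%:M ->
  S \in unitmx /\ invmx S = B^T *m B.
Proof.
move=> BSB; have [BS BT] := mulmx1_unit BSB.
have BTB : B^T *m (B *m S) = 1%:M by apply: mulmx1C.
have uS : S \in unitmx by apply: (mulmx1_unit (A := B^T *m B) _).2; rewrite -mulmxA.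
split => //; apply: (can_inj (mulmxK uS)).
by rewrite mulVmx// -mulmxA.
Qed.

Lemma posdef_det_gt0 (m : nat) (S : 'M[R]_m) : posdef_mx S -> 0 < \det S.
Proof.
move=> /posdef_congr[B BSB].
have : \det S * (\det B) ^+ 2 = 1.
  by rewrite -(det1 R m) -BSB !det_mulmx det_tr; ring.
have B2 := sqr_ge0 (\det B); move=> SB.
rewrite ltNge; apply/negP => S0.
by have := mulr_le0_ge0 S0 B2; rewrite SB ler10.
Qed.

Lemma quad_form_invmx (m : nat) (S B : 'M[R]_m) (x : 'cV[R]_m) :
  B *m S *m B^T = 1%:M ->
  quad_form (invmx S) x = \sum_i ((B *m x) i 0) ^+ 2.
Proof.
move=> /invmx_congr[_ ->]; rewrite /quad_form -!mulmxA mulmxA -trmx_mul !mxE.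
by apply: eq_bigr => i _; rewrite mxE expr2.
Qed.

Lemma log_likE (f : R) (m : nat) (S : 'M[R]_m) (x : 'cV[R]_m) :
  0 < f -> posdef_mx S ->
  log_lik f S x =
  - m%:R * ln f + 1 / 2 * (1 - 1 / f ^+ 2) * quad_form (invmx S) x.
Proof.
move=> f0 pS; have detS := posdef_det_gt0 pS.
have [B BSB] := posdef_congr pS; have [uS _] := invmx_congr BSB.
have f2 : 0 < f ^+ 2 by exact: exprn_gt0.
have fm : 0 < f ^+ m by exact: exprn_gt0.
have c0 : 0 < (2 * pi) ^+ m * \det S :> R.
  by rewrite mulr_gt0// exprn_gt0// mulr_gt0// pi_gt0.
have qE : quad_form (invmx (f ^+ 2 *: S)) x = f ^- 2 * quad_form (invmx S) x.
  rewrite /quad_form invmxZ; last by rewrite unitmxZ ?unitfE ?gt_eqF.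
  by rewrite -scalemxAr -scalemxAl mxE.
rewrite /log_lik /mvn_pdf qE detZ.
have -> : (2 * pi) ^+ m * ((f ^+ 2) ^+ m * \det S)
    = (f ^+ m) ^+ 2 * ((2 * pi) ^+ m * \det S).
  by rewrite exprAC; ring.
rewrite sqrtrM ?exprn_ge0 ?ltW// sqrtr_sqr gtr0_norm//.
set c := Num.sqrt _; have c1 : 0 < c by rewrite sqrtr_gt0.
set q := quad_form _ _.
have -> : expR (- (f ^- 2 * q / 2)) / (f ^+ m * c) / (expR (- (q / 2)) / c)
   = expR (- (f ^- 2 * q / 2) + q / 2) / f ^+ m.
  rewrite expRD [X in _ / (X / c)]expRN; field.
  by rewrite !gt_eqF ?expR_gt0.
rewrite ln_div ?posrE ?expR_gt0// expRK lnXn// -mulr_natl.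
by field; rewrite gt_eqF.
Qed.

End posdef_matrices.

(** * Moments from exponential moments *)

(** An affine function that supports f from below at 0 is the tangent of f. With
f (t) = E exp (t Z) and 1 + t Z <= exp (t Z), this reads the mean of Z off its
moment generating function. *)
Lemma tangent_slope {R : realType} (f : R -> R) (a c e : R) : 0 < e ->
  (forall t, `|t| < e -> derivable f t 1) -> is_derive (0 : R) (1 : R) f c ->
  f 0 = 1 -> (forall t, `|t| < e -> 1 + t * a <= f t) -> a = c.
Proof.
move=> e0 df f'0 f0 fa; pose g t := f t - t * a.
have derivable_mulr_a (t : R) : derivable (fun t : R => t * a) t (1 : R) by [].
have te t : t \in `]- e, e[ -> `|t| < e by rewrite in_itv/= ltr_norml.
have g'c : is_derive (0 : R) 1 g (c - a).
  by apply: is_derive_eq; rewrite /GRing.scale/=; ring.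
have g'0 : is_derive (0 : R) 1 g 0.
  apply: (@derive1_at_min _ g (- e) e); first by lra.
  - move=> t /te/df ft; exact: (derivableB ft (derivable_mulr_a t)).
  - by rewrite in_itv/=; lra.
  - by move=> t /te/fa; rewrite /g mul0r subr0 f0; lra.
have [_ g1] := g'0; have [_] := g'c; rewrite g1; lra.
Qed.

Section chi_square_mean.
Context d (T : measurableType d) (R : realType) (P : probability T R).

Lemma chi_square_mean (m : nat) (Q : T -> R) : measurable_fun [set: T] Q ->
  (forall w, 0 <= Q w) -> has_chi_square_mgf P m Q ->
  P.-integrable [set: T] (EFin \o Q) /\ (\int[P]_w (Q w)%:E = m%:R%:E)%E.
Proof.
move=> mQ Q0 mgfQ.
have mexp t : measurable_fun [set: T] (fun w => expR (t / 2 * Q w)).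
  by apply: measurableT_comp => //; exact: measurable_funM.
have iexp t : t < 1 -> P.-integrable [set: T] (EFin \o (fun w => expR (t / 2 * Q w))).
  by move=> t1; exact: (ge0_integrable_EFin (mexp t) _ (mgfQ t t1)).
have iQ : P.-integrable [set: T] (EFin \o Q).
  have h : (2^-1 : R) < 1 by lra.
  (* 1 + Q / 4 <= exp (Q / 4) *)
  apply: (integrable_dominated mQ _ (integrableZl measurableT 4 (iexp _ h))) => w.
  rewrite ger0_norm//=.
  have := expR_ge1Dx (2^-1 / 2 * Q w); lra.
split => //; rewrite (Rintegral_EFin iQ); congr EFin.
suff : (\int[P]_w Q w)%R / 2 = m%:R / 2 by lra.
pose M (t : R) := expR (- (m%:R / 2 * ln (1 - t))).
have dM (t : R) : `|t| < 1 -> is_derive t (1 : R) M (M t * (m%:R / 2 / (1 - t))).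
  move=> /ltr_normlP[_ t1].
  have : 0 < 1 - t by lra.
  move=> /is_derive1_ln => ?.
  by rewrite /M; apply: is_derive_eq; rewrite /GRing.scale/=; ring.
have M0 : M 0 = 1 by rewrite /M subr0 ln1 mulr0 oppr0 expR0.
have dM0 : is_derive (0 : R) (1 : R) M (m%:R / 2).
  by have := dM 0; rewrite normr0 ltr01 => /(_ isT); rewrite M0 subr0 mul1r divr1.
have derM (t : R) : `|t| < 1 -> derivable M t 1 by move=> /dM[].
apply: (tangent_slope ltr01 derM dM0 M0).
move=> t /ltr_normlP[_ t1]; rewrite -lee_fin -mgfQ//.
have -> : (1 + t * ((\int[P]_w Q w)%R / 2))%:E
    = (\int[P]_w (1 + t / 2 * Q w)%:E)%E.
  under eq_integral do rewrite EFinD.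
  rewrite integralD_EFin//=; last 2 first.
  - exact: finite_measure_integrable_cst.
  - exact: (integrableZl measurableT (t / 2) iQ).
  rewrite integral_cst//= probability_setT mul1e EFinD; congr (_ + _)%E.
  under eq_integral do rewrite EFinM.
  by rewrite integralZl// (Rintegral_EFin iQ) -EFinM; congr EFin; ring.
apply: le_integral => //.
- rewrite (_ : (fun w => (1 + t / 2 * Q w)%:E) =
    (EFin \o cst 1%R) \+ (EFin \o (fun w => t / 2 * Q w)%R))%E//.
  apply: integrableD => //; first exact: finite_measure_integrable_cst.
  exact: (integrableZl measurableT (t / 2) iQ).
- exact: iexp.
- by move=> w _; rewrite lee_fin expR_ge1Dx.
Qed.

End chi_square_mean.

(** * Variables with a normal law *)
Section law_of_a_variable.
Context d (T : measurableType d) (R : realType) (P : probability T R).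
Variables (W : T -> R) (mW : measurable_fun [set: T] W).

Let W_mixin := @isMeasurableFun.Build _ _ T (measurableTypeR R) W mW.
Let Wfun : {mfun T >-> measurableTypeR R} := HB.pack W W_mixin.

Lemma ge0_integral_law (nu : {measure set (measurableTypeR R) -> \bar R})
    (h : R -> R) :
  (forall A : set R, measurable A -> P (W @^-1` A) = nu A) ->
  measurable_fun [set: R] h -> (forall x, 0 <= h x) ->
  (\int[P]_w (h (W w))%:E = \int[nu]_x (h x)%:E)%E.
Proof.
move=> PW mh h0.
transitivity (\int[pushforward P Wfun]_x (h x)%:E)%E.
  rewrite ge0_integral_pushforward//; first by apply/measurable_EFinP.
  by move=> x _; rewrite lee_fin.
by apply: eq_measure_integral => A mA _; exact: PW.
Qed.

Hypothesis normalW : normal_law P W.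

(** The degenerate and the nondegenerate normal laws satisfy the same formulas,
with s = 0 in the first case. *)
Lemma normal_law_expR : exists mu s : R, 0 <= s /\
  [/\ forall t, (\int[P]_w (expR (t * W w))%:E
               = (expR (t * mu + s ^+ 2 * t ^+ 2 / 2))%:E)%E,
      mu = 0 -> forall t, t * s ^+ 2 < 1 ->
              (\int[P]_w (expR (t / 2 * W w ^+ 2))%:E
               = (expR (- (ln (1 - t * s ^+ 2) / 2)))%:E)%E &
      mu = 0 -> (\int[P]_w (1 + cos (W w))%:E
               = (1 + expR (- (s ^+ 2 / 2)))%:E)%E].
Proof.
have mexp t : measurable_fun [set: R] (fun x => expR (t * x)).
  by apply: measurableT_comp => //; exact: measurable_funM.
have msqr t : measurable_fun [set: R] (fun x => expR (t / 2 * x ^+ 2)).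
  by apply: measurableT_comp => //; apply: measurable_funM.
have mcos : measurable_fun [set: R] (fun x => 1 + cos x).
  apply: measurable_funD => //; apply: continuous_measurable_fun.
  exact: continuous_cos.
have cos0 x : 0 <= 1 + cos x :> R by rewrite -lerBlDl sub0r cos_geN1.
have [mu [lawW|[s s0 lawW]]] := normalW; exists mu.
- have lawE (h : R -> R) : measurable_fun [set: R] h -> (forall x, 0 <= h x) ->
      (\int[P]_w (h (W w))%:E = (h mu)%:E)%E.
    move=> mh h0; rewrite (@ge0_integral_law (\d_(mu : measurableTypeR R)) _ lawW)//.
    rewrite integral_dirac//.
      by rewrite diracT mul1e.
    by apply/measurable_EFinP.
  exists 0; split=> //; split.
  + move=> t; rewrite (lawE (fun x => expR (t * x)))//.
    by rewrite expr0n/= !mul0r addr0.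
  + move=> mu0 t _; rewrite (lawE (fun x => expR (t / 2 * x ^+ 2)))//.
    by rewrite mu0 expr0n/= !mulr0 subr0 ln1 mul0r oppr0.
  + move=> mu0; rewrite (lawE (fun x => 1 + cos x))// mu0 trigo.cos0.
    by rewrite expr0n/= mul0r oppr0 expR0.
- exists s; split; first exact: ltW.
  have s_neq0 : s != 0 by rewrite gt_eqF.
  split.
  + move=> t; rewrite (@ge0_integral_law (normal_prob mu s) _ lawW (mexp t)).
      exact: integral_expR_normal_prob.
    by move=> x; exact: expR_ge0.
  + move=> mu0 t ts.
    rewrite (@ge0_integral_law (normal_prob mu s) _ lawW (msqr t)); last first.
      by move=> x; exact: expR_ge0.
    rewrite mu0 -integral_expR_sqr_normal_prob//.
    by apply: eq_integral => x _; rewrite mulrAC.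
  + move=> mu0; rewrite (@ge0_integral_law (normal_prob mu s) _ lawW mcos)// mu0.
    have iC : (normal_prob 0 s : {measure set _ -> \bar R}).-integrable [set: R]
        (EFin \o (fun x : R => cos x)).
      apply: (integrable_dominated (g := cst 1)) => //.
      * by apply: continuous_measurable_fun; exact: continuous_cos.
      * exact: cos_max.
      * exact: finite_measure_integrable_cst.
    under eq_integral do rewrite EFinD.
    rewrite integralD_EFin//=; last exact: finite_measure_integrable_cst.
    rewrite integral_cst//= mul1e EFinD; congr (_ + _)%E.
      exact: (@probability_setT _ _ _ (normal_prob 0 s : probability _ _)).
    have := integral_cos_normal_prob s0 0 1.
    rewrite trigo.cos0 mul1r expr1n mulr1 => <-.
    by apply: eq_integral => x _; rewrite add0r mul1r.
Qed.

End law_of_a_variable.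

Section centered_normal_variable.
Context d (T : measurableType d) (R : realType) (P : probability T R).
Variables (W : T -> R) (mW : measurable_fun [set: T] W).
Hypothesis normalW : normal_law P W.

Lemma normal_law_integrable : P.-integrable [set: T] (EFin \o W).
Proof.
have [mu [s [s0 [expW _ _]]]] := normal_law_expR mW normalW.
have mexp t : measurable_fun [set: T] (fun w => expR (t * W w)).
  by apply: measurableT_comp => //; exact: measurable_funM.
have iexp t : P.-integrable [set: T] (EFin \o (fun w => expR (t * W w))).
  by exact: (ge0_integrable_EFin (mexp t) _ (expW t)).
apply: (integrable_dominated (g := fun w => expR (1 * W w) + expR (- 1 * W w))) => //.
  by move=> w; rewrite mul1r mulN1r ler_norm_expR.
exact: (integrableD measurableT (iexp 1) (iexp (- 1))).
Qed.

(** The exponential moments show that the mean parameter is 0 and, through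
[chi_square_mean] applied to (W / s)^2, that s^2 is the second moment. The
formula for cos is stated for 1 + cos, which is nonnegative. *)
Lemma centered_normal_law : (\int[P]_w (W w)%:E = 0)%E ->
  exists v : R, P.-integrable [set: T] (EFin \o (fun w => W w ^+ 2)) /\
  [/\ (\int[P]_w (W w ^+ 2)%:E = v%:E)%E,
      (\int[P]_w (expR (W w))%:E = (expR (v / 2))%:E)%E &
      (\int[P]_w (1 + cos (W w))%:E = (1 + expR (- (v / 2)))%:E)%E].
Proof.
move=> EW0; have [mu [s [s0 [expW sqrW cosW]]]] := normal_law_expR mW normalW.
have iW := normal_law_integrable.
have mu0 : mu = 0.
  pose M (t : R) := expR (t * mu + s ^+ 2 * t ^+ 2 / 2).
  have M0 : M 0 = 1 by rewrite /M expr0n/= !(mul0r, mulr0) addr0 expR0.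
  have dM (t : R) : is_derive t (1 : R) M (M t * (mu + s ^+ 2 * t)).
    by rewrite /M; apply: is_derive_eq; rewrite /GRing.scale/= !mulr0; field.
  have dM0 : is_derive (0 : R) (1 : R) M mu.
    by have := dM 0; rewrite M0 mulr0 addr0 mul1r.
  have derM (t : R) : `|t| < 1 -> derivable M t 1 by case: (dM t).
  apply/esym; apply: (tangent_slope ltr01 derM dM0 M0) => t _.
  rewrite mulr0 addr0 -lee_fin /M -expW.
  have -> : (1%:E = \int[P]_w (1 + t * W w)%:E)%E.
    under eq_integral do rewrite EFinD.
    rewrite integralD_EFin//=; last 2 first.
    - exact: finite_measure_integrable_cst.
    - exact: (integrableZl measurableT t iW).
    rewrite integral_cst//= probability_setT mul1e.
    under eq_integral do rewrite EFinM.
    by rewrite integralZl// EW0 mule0 adde0.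
  apply: le_integral => //.
  - rewrite (_ : (fun w => (1 + t * W w)%:E) =
      (EFin \o cst 1%R) \+ (EFin \o (fun w => t * W w)%R))%E//.
    apply: integrableD => //; first exact: finite_measure_integrable_cst.
    exact: (integrableZl measurableT t iW).
  - apply: (ge0_integrable_EFin _ _ (expW t)) => //.
    by apply: measurableT_comp => //; exact: measurable_funM.
  - by move=> w _; rewrite lee_fin expR_ge1Dx.
have mW2 : measurable_fun [set: T] (fun w => W w ^+ 2) by exact: measurable_funX.
exists (s ^+ 2).
have [iW2 EW2] : P.-integrable [set: T] (EFin \o (fun w => W w ^+ 2)) /\
    (\int[P]_w (W w ^+ 2)%:E = (s ^+ 2)%:E)%E.
  (* When s = 0, W^2 is a chi-square variable without degrees of freedom. *)
  move: s0; rewrite le_eqVlt => /predU1P[s0|s0].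
    rewrite -s0 expr0n/=; apply: (chi_square_mean (m := 0)) => //.
      by move=> w; exact: sqr_ge0.
    move=> t t1; rewrite sqrW// -s0 expr0n/= ?mulr0 ?ltr01//.
    by rewrite subr0 ln1 !mul0r.
  have s2 : s ^+ 2 != 0 by rewrite gt_eqF// exprn_gt0.
  have [] := @chi_square_mean _ T R P 1 (fun w => s ^- 2 * W w ^+ 2).
  - exact: measurable_funM.
  - by move=> w; rewrite mulr_ge0 ?sqr_ge0// invr_ge0 sqr_ge0.
  - move=> t t1.
    have := sqrW mu0 (t * s ^- 2); rewrite divfK// => /(_ t1).
    rewrite (mulrC _ (ln _)) mul1r => <-.
    by apply: eq_integral => w _; rewrite mulrA (mulrAC t).
  move=> iV EV.
  have W2E w : W w ^+ 2 = s ^+ 2 * (s ^- 2 * W w ^+ 2).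
    by rewrite mulrA divff// mul1r.
  split.
    have := integrableZl measurableT (s ^+ 2) iV; congr (_.-integrable _ _).
    by apply/funext => w; rewrite /= -EFinM -W2E.
  under eq_integral do rewrite W2E EFinM.
  by rewrite integralZl// EV mule1.
split => //; split=> //.
- have := expW 1; rewrite mu0 mulr0 add0r expr1n mulr1 => <-.
  by apply: eq_integral => w _; rewrite mul1r.
- exact: cosW.
Qed.

End centered_normal_variable.

Lemma ge0_integral_eq_law d (T : measurableType d) (R : realType)
    (P : probability T R) (W V : T -> R) (h : R -> R) :
  measurable_fun [set: T] W -> measurable_fun [set: T] V ->
  (forall A : set R, measurable A -> P (W @^-1` A) = P (V @^-1` A)) ->
  measurable_fun [set: R] h -> (forall x, 0 <= h x) ->
  (\int[P]_w (h (W w))%:E = \int[P]_w (h (V w))%:E)%E.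
Proof.
move=> mW mV WV mh h0.
pose V_mixin := @isMeasurableFun.Build _ _ T (measurableTypeR R) V mV.
pose Vfun : {mfun T >-> measurableTypeR R} := HB.pack V V_mixin.
rewrite (ge0_integral_law mW (nu := pushforward P Vfun))//.
by rewrite (ge0_integral_law mV (nu := pushforward P Vfun)).
Qed.

(** * The quadratic form of a stationary Gaussian sample *)
Section gaussian_process.
Context d (T : measurableType d) (R : realType) (P : probability T R).
Variable X : nat -> {RV P >-> R}.
Hypothesis X_gaussian : gaussian_sequence X.
Hypothesis X_stationary : stationary X.
Hypothesis X_centered : forall i : nat, ('E_P[X i] = 0)%E.

Let mX i : measurable_fun [set: T] (X i). Proof. exact: measurable_funPT. Qed.

Lemma measurable_linear_combination m h (a : 'I_m -> R) :
  measurable_fun [set: T] (fun w => \sum_(i < m) a i * X (h + i)%N w).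
Proof. by apply: measurable_sum => i; exact: measurable_funM. Qed.

Lemma stationary_linear_combination m h (a : 'I_m -> R) (A : set R) :
  measurable A ->
  P ((fun w => \sum_(i < m) a i * X (h + i)%N w) @^-1` A)
  = P ((fun w => \sum_(i < m) a i * X i w) @^-1` A).
Proof.
move=> mA.
pose L (t : m.-tuple R) := \sum_(i < m) a i * tnth t i.
have mL : measurable_fun [set: m.-tuple R] L.
  apply: measurable_sum => i; apply: measurable_funM => //.
  exact: measurable_tnth.
have := X_stationary h (A := L @^-1` A).
have mLA : measurable (L @^-1` A) by rewrite -[X in measurable X]setTI; exact: mL.
move=> /(_ mLA).
have LE k : [set w | (L @^-1` A) [tuple X (k + i)%N w | i < m]]
    = (fun w => \sum_(i < m) a i * X (k + i)%N w) @^-1` A.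
  apply/seteqP; split => w /=; congr (A _); apply: eq_bigr => i _;
  by rewrite tnth_mktuple.
by rewrite LE (LE 0).
Qed.

Lemma gaussian_sequence_normal i : normal_law P (X i).
Proof.
have := X_gaussian (fun j : 'I_i.+1 => (j == ord_max)%:R).
congr (normal_law P _); apply/funext => w.
rewrite (bigD1 ord_max)//= eqxx mul1r big1 ?addr0// => j /negbTE ->.
by rewrite mul0r.
Qed.

Lemma integral_process i : (\int[P]_w (X i w)%:E = 0)%E.
Proof. by have := X_centered i; rewrite unlock. Qed.

Lemma integrable_process i : P.-integrable [set: T] (EFin \o X i).
Proof. exact: (normal_law_integrable (mX i) (gaussian_sequence_normal i)). Qed.

Lemma integrable_process_prod i j :
  P.-integrable [set: T] (EFin \o (fun w => X i w * X j w)).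
Proof.
have sqr k : P.-integrable [set: T] (EFin \o (fun w => X k w ^+ 2)).
  by have [v []] := centered_normal_law (mX k) (gaussian_sequence_normal k)
    (integral_process k).
apply: (integrable_dominated (g := fun w => X i w ^+ 2 + X j w ^+ 2)).
- exact: measurable_funM.
- move=> w; have := sqr_ge0 (X i w - X j w); have := sqr_ge0 (X i w + X j w).
  by rewrite ler_norml => ? ?; apply/andP; split; nra.
- exact: (integrableD measurableT (sqr i) (sqr j)).
Qed.

Lemma cov_mxE m (i j : 'I_m) :
  cov_mx X m i j = (\int[P]_w (X i w * X j w))%R.
Proof.
rewrite mxE /Rintegral; congr fine; rewrite unlock !X_centered/= unlock.
by apply: eq_integral => w _; rewrite !fctE/= !subr0.
Qed.

Lemma integral_linear_combination_sqr m (a : 'I_m -> R) :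
  (\int[P]_w ((\sum_(i < m) a i * X i w) ^+ 2)%:E
   = (quad_form (cov_mx X m) (\col_i a i))%:E)%E.
Proof.
transitivity (\int[P]_w
    \sum_(i < m) \sum_(j < m) ((a i * a j) * (X i w * X j w))%:E)%E.
  apply: eq_integral => w _; rewrite expr2 mulr_suml -sumEFin.
  apply: eq_bigr => i _.
  by rewrite mulr_sumr -sumEFin; apply: eq_bigr => j _; congr EFin; ring.
have int_ij i j : P.-integrable [set: T] (fun w => ((a i * a j) * (X i w * X j w))%:E).
  exact: (integrableZl measurableT (a i * a j) (integrable_process_prod i j)).
have int_i i : P.-integrable [set: T]
    (fun w => \sum_(j < m) ((a i * a j) * (X i w * X j w))%:E)%E.
  by apply: integrable_sum => // j _; exact: int_ij.
rewrite (integral_sum measurableT int_i).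
have row i : (\int[P]_w \sum_(j < m) ((a i * a j) * (X i w * X j w))%:E
    = (\sum_(j < m) a i * a j * cov_mx X m i j)%:E)%E.
  rewrite (integral_sum measurableT (int_ij i)) -sumEFin; apply: eq_bigr => j _.
  under eq_integral do rewrite EFinM.
  rewrite integralZl//; last exact: integrable_process_prod.
  by rewrite (Rintegral_EFin (integrable_process_prod i j)) cov_mxE.
under eq_bigr => i _ do rewrite row.
rewrite sumEFin; congr EFin; rewrite /quad_form mxE exchange_big/=.
apply: eq_bigr => j _; rewrite [(_ *m _) _ _]mxE mulr_suml.
by apply: eq_bigr => i _; rewrite [(_^T) _ _]mxE ![(\col_ _ _) _ _]mxE mulrAC.
Qed.

(** Stationarity gives the combination of the shifted sample the law of the same
combination of the first m observations, whose variance is a quadratic form in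
[cov_mx X m]. *)
Lemma linear_combination_mgf m h (a : 'I_m -> R) :
  let W w := \sum_(i < m) a i * X (h + i)%N w in
  let v := quad_form (cov_mx X m) (\col_i a i) in
  (\int[P]_w (expR (W w))%:E = (expR (v / 2))%:E)%E /\
  (\int[P]_w (cos (W w))%:E = (expR (- (v / 2)))%:E)%E.
Proof.
move=> W v; pose W0 w := \sum_(i < m) a i * X (0 + i)%N w.
have mW0 : measurable_fun [set: T] W0 := measurable_linear_combination 0 a.
have mW : measurable_fun [set: T] W := measurable_linear_combination h a.
have normalW : normal_law P W.
  have [mu lawW] := X_gaussian a; exists mu; move: lawW.
  case=> [lawW|[s s0 lawW]]; [left|right; exists s => //];
  by move=> A mA; rewrite stationary_linear_combination// lawW.
have iX i : P.-integrable [set: T] (EFin \o (fun w => a i * X (h + i)%N w)).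
  exact: (integrableZl measurableT (a i) (integrable_process _)).
have EW : (\int[P]_w (W w)%:E = 0)%E.
  under eq_integral do rewrite /W -sumEFin.
  rewrite (integral_sum measurableT iX) big1// => i _.
  under eq_integral do rewrite /= EFinM.
  by rewrite integralZl ?integral_process ?mule0//; exact: integrable_process.
have [u [iW2 [W2 expW cosW]]] := centered_normal_law mW normalW EW.
have uv : u = v.
  apply: EFin_inj; rewrite -W2 -integral_linear_combination_sqr.
  apply: (ge0_integral_eq_law mW mW0 _ (h := fun x => x ^+ 2)).
  - exact: stationary_linear_combination.
  - exact: measurable_funX.
  - by move=> x; exact: sqr_ge0.
rewrite -uv; split => //.
have icos : P.-integrable [set: T] (EFin \o (fun w => cos (W w))).
  apply: (integrable_dominated (g := cst 1)).
  - apply: (measurableT_comp (f := @cos R)) => //.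
    by apply: continuous_measurable_fun; exact: continuous_cos.
  - by move=> w; exact: cos_max.
  - exact: finite_measure_integrable_cst.
move: cosW; under eq_integral do rewrite EFinD.
rewrite integralD_EFin//=; last exact: finite_measure_integrable_cst.
rewrite integral_cst//= probability_setT mul1e (Rintegral_EFin icos) -EFinD.
by move=> -[] /addrI ->.
Qed.

Section quadratic_form.
Variables (m h : nat).
Hypothesis posS : posdef_mx (cov_mx X m).

Let x w : 'cV[R]_m := \col_i X (h + i)%N w.

Lemma measurable_quad_form (S : 'M[R]_m) :
  measurable_fun [set: T] (fun w => quad_form S (x w)).
Proof.
rewrite (_ : (fun w => _) =
    fun w => \sum_(j < m) (\sum_(i < m) X (h + i)%N w * S i j) * X (h + j)%N w).
  apply: measurable_sum => j; apply: measurable_funM => //.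
  by apply: measurable_sum => i; exact: measurable_funM.
apply/funext => w; rewrite /quad_form mxE; apply: eq_bigr => j _.
rewrite [(_ *m _) _ _]mxE [x w j _]mxE; congr (_ * _).
by apply: eq_bigr => i _; rewrite [(_^T) _ _]mxE [x w i _]mxE.
Qed.

(** With B Sigma B^T = 1, a linear combination of the coordinates of B x with
coefficients c is one of the observations with variance |c|^2, which is what
[chi_square_mgf] requires. *)
Lemma quad_form_chi_square_mgf :
  has_chi_square_mgf P m (fun w => quad_form (invmx (cov_mx X m)) (x w)).
Proof.
have [B BSB] := posdef_congr posS.
(* [chi_square_mgf] is stated for sequences: extend by 0 beyond m. *)
pose Y i w := if insub i is Some k then (B *m x w) k 0 else 0.
have YE (k : 'I_m) w : Y k w = (B *m x w) k 0.
  by rewrite /Y valK.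
have mY i : measurable_fun [set: T] (Y i).
  rewrite /Y; case: insub => [k|]; last exact: measurable_cst.
  rewrite (_ : (fun w => _) = fun w => \sum_(j < m) B k j * X (h + j)%N w).
    exact: measurable_linear_combination.
  by apply/funext => w; rewrite mxE; apply: eq_bigr => j _; rewrite [x w j _]mxE.
have lin (c : nat -> R) w : \sum_(0 <= i < m) c i * Y i w =
    \sum_(j < m) ((\row_k c k) *m B) 0 j * X (h + j)%N w.
  rewrite big_mkord; transitivity (((\row_k c k) *m (B *m x w)) (0 : 'I_1) 0).
    by rewrite mxE; apply: eq_bigr => k _; rewrite YE [(\row__ _) _ _]mxE.
  by rewrite mulmxA mxE; apply: eq_bigr => j _; rewrite [x w j _]mxE.
have var (c : nat -> R) : quad_form (cov_mx X m)
    (\col_j ((\row_(k < m) c k) *m B) 0 j) = \sum_(0 <= i < m) c i ^+ 2.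
  have -> : \col_j ((\row_(k < m) c k) *m B) 0 j = ((\row_(k < m) c k) *m B)^T.
    by apply/matrixP => i j; rewrite mxE [RHS]mxE ord1.
  rewrite /quad_form trmxK trmx_mul !mulmxA.
  rewrite -(mulmxA _ B) -(mulmxA _ (B *m _)) BSB mulmx1.
  rewrite mxE big_mkord; apply: eq_bigr => k _.
  by rewrite [(_^T) _ _]mxE ![(\row__ _) _ _]mxE expr2.
move=> t t1.
have := @chi_square_mgf _ T R P m Y mY t t1.
have expY (c : nat -> R) : (\int[P]_w (expR (\sum_(0 <= i < m) c i * Y i w))%:E
     = (expR ((\sum_(0 <= i < m) c i ^+ 2) / 2))%:E)%E.
  under eq_integral do rewrite lin.
  by rewrite (linear_combination_mgf h _).1 var.
have cosY (c : nat -> R) : (\int[P]_w (cos (\sum_(0 <= i < m) c i * Y i w))%:E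
     = (expR (- ((\sum_(0 <= i < m) c i ^+ 2) / 2)))%:E)%E.
  under eq_integral do rewrite lin.
  by rewrite (linear_combination_mgf h _).2 var.
move=> /(_ expY cosY) <-; apply: eq_integral => w _.
rewrite (quad_form_invmx _ BSB) big_mkord; congr (expR (_ * _))%:E.
by apply: eq_bigr => i _; rewrite YE.
Qed.

End quadratic_form.
End gaussian_process.

(** * The rate function *)
Section rate_function.
Context {R : realType}.
Variables (f beta b : R).
Hypotheses (f_gt0 : 0 < f) (f_neq1 : f != 1) (beta_lt1 : beta < 1).

(** The derivative in theta of the argument of the logarithm in [rate_obj]. *)
Definition tilt_slope : R := 1 / f ^+ 2 - 1.
(** The value of Q / m at which the log-likelihood ratio equals n b. *)
Definition critical_ratio : R := - 2 / tilt_slope * (b / (1 - beta) + ln f).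

Local Notation c := tilt_slope.
Local Notation u := critical_ratio.

Hypothesis u_gt0 : 0 < u.

Lemma tilt_slope_neq0 : c != 0.
Proof.
rewrite subr_eq0 div1r invr_eq1; apply: contra f_neq1 => /eqP f2.
have /eqP : f ^+ 2 = 1 by [].
by rewrite sqrf_eq1 => /orP[//|/eqP fN1]; move: f_gt0; rewrite fN1 ltr0N1.
Qed.

Let c0 := tilt_slope_neq0.
Let B0 : 0 < 1 - beta. Proof. by rewrite subr_gt0. Qed.

Lemma critical_ratioE : b + (1 - beta) * ln f = - u * c * (1 - beta) / 2.
Proof. by rewrite /u; field; rewrite c0/= gt_eqF. Qed.

Definition optimal_tilt : R :=
  - (1 / 2 * (1 - beta) / (b + (1 - beta) * ln f) + 1 / c).

Lemma optimal_tiltE : 1 + c * optimal_tilt = u^-1.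
Proof.
rewrite /optimal_tilt critical_ratioE; field.
by rewrite c0 !gt_eqF.
Qed.

Lemma rate_domE theta : rate_dom f theta = (0 < 1 + c * theta) :> Prop.
Proof. by rewrite /rate_dom/=; congr (is_true (0 < _)); rewrite /c; ring. Qed.

Lemma rate_objE theta : rate_obj f beta b theta =
  (1 - beta) / 2 * (ln (1 + c * theta) - u * (1 + c * theta) + u).
Proof.
rewrite /rate_obj.
have -> : theta / f ^+ 2 + (1 - theta) = 1 + c * theta by rewrite /c; ring.
have -> : theta * b + theta * (1 - beta) * ln f
    = theta * (- u * c * (1 - beta) / 2) by rewrite -critical_ratioE; ring.
by field.
Qed.

Lemma rate_obj_optimal :
  rate_obj f beta b optimal_tilt = (1 - beta) * chi_square_rate u.
Proof.
rewrite rate_objE optimal_tiltE lnV ?posrE// divff ?gt_eqF// /chi_square_rate.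
by field.
Qed.

(** ln (u y) < u y - 1 for u y != 1, with y = 1 + c theta. *)
Lemma rate_obj_le theta : 0 < 1 + c * theta -> theta != optimal_tilt ->
  rate_obj f beta b theta < (1 - beta) * chi_square_rate u.
Proof.
move=> y0 tN; rewrite rate_objE /chi_square_rate.
set y := 1 + c * theta in y0 *.
have uy : 0 < u * y by exact: mulr_gt0.
have uyN : ln (u * y) != 0.
  rewrite ln_eq0//; apply: contra_neq tN => uy1.
  have : c * theta = c * optimal_tilt.
    apply: (addrI 1); rewrite optimal_tiltE -/y.
    by apply: (mulfI (lt0r_neq0 u_gt0)); rewrite uy1 divff ?gt_eqF.
  by move/(mulfI c0).
have := expR_gt1Dx uyN; rewrite lnK// lnM// => lt1.
rewrite -mulrA ltr_pM2l// (mulrC 2^-1) ltr_pM2r//; lra.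
Qed.

Lemma rateE : rate f beta b = ((1 - beta) * chi_square_rate u)%:E.
Proof.
apply/eqP; rewrite eq_le; apply/andP; split.
  apply: ge_ereal_sup => _ [theta + <-]; rewrite rate_domE => y0.
  rewrite lee_fin; have [->|tN] := eqVneq theta optimal_tilt.
    by rewrite rate_obj_optimal.
  exact/ltW/rate_obj_le.
apply: ereal_sup_ubound; exists optimal_tilt; last by rewrite rate_obj_optimal.
by rewrite rate_domE optimal_tiltE invr_gt0.
Qed.

Lemma optimizes_rateP theta :
  optimizes_rate f beta b theta <-> theta = optimal_tilt.
Proof.
rewrite /optimizes_rate rateE rate_domE; split=> [[y0 [tE]]|->]; last first.
  by rewrite optimal_tiltE invr_gt0 rate_obj_optimal.
by apply/eqP; apply: contraT => /(rate_obj_le y0); rewrite tE ltxx.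
Qed.

End rate_function.

Lemma post_sizeE {R : realType} (beta : R) (n : nat) :
  0 <= beta -> beta < 1 -> admissible beta n ->
  (post_size beta n)%:R = n%:R * (1 - beta).
Proof.
move=> b0 b1 [n0 nb].
have nbN : n%:R * beta \is a Num.nat by rewrite natrEint nb mulr_ge0.
have cE : (change_pt beta n)%:R = n%:R * beta by rewrite /change_pt truncnK.
rewrite /post_size natrB ?cE; first by ring.
by rewrite -(ler_nat R) cE ler_piMr// ltW.
Qed.

(** * Asymptotics of the false alarm probability *)

(** The filter F may be improper: when n beta is an integer for no
large n, the restriction to such n makes every limit hold. *)
Lemma cvg_normalized_lne {R : realType} (F : set_system nat) (FF : Filter F)
    (p : nat -> \bar R) (a J : R) :
  (\forall n \near F, p n \is a fin_num) ->
  (\forall n \near F, (0 < n)%N) ->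
  (\forall n \near F, fine (p n) <= expR (- (n%:R * (a * J)))) ->
  (forall eps, 0 < eps ->
    \forall n \near F, expR (- (n%:R * (a * (J + eps)))) <= fine (p n)) ->
  0 < a ->
  ((n%:R^-1)%:E * lne (p n))%E @[n --> F] --> (- (a * J)%:E)%E.
Proof.
move=> pfin n_gt0 pub plb a0; rewrite -EFinN.
have lneE : \forall n \near F,
    ((n%:R^-1)%:E * lne (p n))%E = (n%:R^-1 * ln (fine (p n)))%:E.
  near=> n.
  have pn : 0 < fine (p n).
    by apply: (lt_le_trans (expR_gt0 (- (n%:R * (a * (J + 1))))));
      near: n; exact: plb.
  have -> : p n = (fine (p n))%:E by rewrite fineK//; near: n.
  by rewrite lne_EFin.
apply/fine_cvgP; split; first by near=> n; rewrite (near lneE n).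
apply/cvgrPdist_le => e e0; have e'0 : 0 < e / a by rewrite divr_gt0.
near=> n.
rewrite /= (near lneE n)//=.
have n0 : 0 < n%:R :> R by rewrite ltr0n; near: n.
have lb : expR (- (n%:R * (a * (J + e / a)))) <= fine (p n).
  by near: n; exact: plb.
have ub : fine (p n) <= expR (- (n%:R * (a * J))) by near: n.
have pn : 0 < fine (p n) by apply: lt_le_trans lb; exact: expR_gt0.
have lnlb : - (n%:R * (a * (J + e / a))) <= ln (fine (p n)).
  by rewrite -[leLHS]expRK ler_ln ?posrE ?expR_gt0.
have lnub : ln (fine (p n)) <= - (n%:R * (a * J)).
  by rewrite -[leRHS]expRK ler_ln ?posrE ?expR_gt0.
have i0 : 0 <= n%:R^-1 :> R by rewrite invr_ge0 ltW.
have h1 := ler_wpM2l i0 lnub; have h2 := ler_wpM2l i0 lnlb.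
have e1 : n%:R^-1 * (- (n%:R * (a * J))) = - (a * J) by field; rewrite gt_eqF.
have e2 : n%:R^-1 * (- (n%:R * (a * (J + e / a)))) = - (a * J) - e.
  by field; rewrite !gt_eqF.
by rewrite e1 in h1; rewrite e2 in h2; rewrite ler_norml; apply/andP; split; lra.
Unshelve. all: by end_near. Qed.

Section likelihood_statistic.
Context d (T : measurableType d) (R : realType) (P : probability T R).
Variables (X : nat -> {RV P >-> R}) (f beta b : R).
Hypotheses (f_gt0 : 0 < f) (f_neq1 : f != 1).
Hypotheses (beta_ge0 : 0 <= beta) (beta_lt1 : beta < 1).
Hypotheses (X_gaussian : gaussian_sequence X) (X_stationary : stationary X).
Hypothesis X_centered : forall i : nat, ('E_P[X i] = 0)%E.
Hypothesis X_posdef : forall m : nat, posdef_mx (cov_mx X m).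

Local Notation c := (tilt_slope f).
Local Notation u := (critical_ratio f beta b).

Definition post_quad_form (n : nat) (w : T) : R :=
  quad_form (invmx (cov_mx X (post_size beta n))) (post_sample X beta n w).

Lemma measurable_post_quad_form n : measurable_fun [set: T] (post_quad_form n).
Proof. exact: measurable_quad_form. Qed.

Lemma post_quad_form_chi_square_mgf n :
  has_chi_square_mgf P (post_size beta n) (post_quad_form n).
Proof. exact: quad_form_chi_square_mgf. Qed.

Lemma post_quad_form_ge0 n w : 0 <= post_quad_form n w.
Proof.
have [B BSB] := posdef_congr (X_posdef (post_size beta n)).
rewrite /post_quad_form (quad_form_invmx _ BSB) sumr_ge0// => i _.
exact: sqr_ge0.
Qed.

Lemma log_lik_statE n w : log_lik_stat X f beta n w =
  - (post_size beta n)%:R * ln f - c / 2 * post_quad_form n w.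
Proof.
rewrite /log_lik_stat log_likE//; congr (_ + _).
by rewrite -/(post_quad_form n w) /tilt_slope; field; rewrite gt_eqF.
Qed.

Lemma expectation_log_lik_stat n :
  ('E_P[log_lik_stat X f beta n]
   = ((post_size beta n)%:R * (- ln f - c / 2))%:E)%E.
Proof.
have [iQ EQ] := chi_square_mean (measurable_post_quad_form n)
  (post_quad_form_ge0 n) (@post_quad_form_chi_square_mgf n).
rewrite unlock; under eq_integral do rewrite log_lik_statE EFinB.
rewrite integralB_EFin//=; last 2 first.
- exact: finite_measure_integrable_cst.
- exact: (integrableZl measurableT (c / 2) iQ).
rewrite integral_cst//= probability_setT mule1.
under eq_integral do rewrite EFinM.
rewrite integralZl// EQ -EFinM -EFinB; congr EFin; ring.
Qed.

(** At each n with n beta an integer the normalized mean is exactly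
(1 - beta) (- ln f - c / 2), and this is less than b precisely when u - 1 has
the sign of - c. *)
Lemma mean_lt_threshold (l : R) :
  ((n%:R^-1)%:E * 'E_P[log_lik_stat X f beta n])%E
    @[n --> within (admissible beta) \oo] --> l%:E ->
  l < b -> 0 < u ->
  \forall n \near within (admissible beta) \oo, 0 < - c * (u - 1).
Proof.
move=> El lb u0.
have near_lt : \forall n \near within (admissible beta) \oo,
    ((n%:R^-1)%:E * 'E_P[log_lik_stat X f beta n] < b%:E)%E.
  by apply: (El (fun y => y < b%:E)%E); apply: open_ereal_lt'; rewrite lte_fin.
near=> n.
have nadm : admissible beta n by near: n; exact: near_withinT.
have n0 : 0 < n%:R :> R by rewrite ltr0n; case: nadm.
have : ((n%:R^-1)%:E * 'E_P[log_lik_stat X f beta n] < b%:E)%E by near: n.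
rewrite expectation_log_lik_stat -EFinM lte_fin (post_sizeE beta_ge0 beta_lt1 nadm).
have -> : n%:R^-1 * (n%:R * (1 - beta) * (- ln f - c / 2))
    = (1 - beta) * (- ln f - c / 2) by field; rewrite gt_eqF.
have := critical_ratioE b f_gt0 f_neq1 beta_lt1 => bE.
have B0 : 0 < 1 - beta by rewrite subr_gt0.
move=> lt_b; rewrite -(pmulr_lgt0 _ B0); lra.
Unshelve. all: by end_near. Qed.

(** n^-1 times the log-likelihood ratio minus b equals - c (Q - m u) / (2 n), and
- c has the sign of u - 1. *)
Lemma log_lik_eventE n : admissible beta n -> 0 < - c * (u - 1) ->
  [set w | b <= n%:R^-1 * log_lik_stat X f beta n w]
  = [set w | 0 <= (u - 1) * (post_quad_form n w - (post_size beta n)%:R * u)].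
Proof.
move=> nadm cu; have n0 : 0 < n%:R :> R by rewrite ltr0n; case: nadm.
have bE := critical_ratioE b f_gt0 f_neq1 beta_lt1.
apply/funext => w /=; congr is_true; rewrite log_lik_statE -subr_ge0.
rewrite (post_sizeE beta_ge0 beta_lt1 nadm).
(* u mentions b: hide it before rewriting b. *)
move: cu bE; set v := critical_ratio f beta b => cu bE.
set z := post_quad_form n w - _.
have -> : n%:R^-1 *
    (- (n%:R * (1 - beta)) * ln f - c / 2 * post_quad_form n w) - b
    = - c / (2 * n%:R) * z.
  have -> : b = - v * c * (1 - beta) / 2 - (1 - beta) * ln f by rewrite -bE; ring.
  by rewrite /z; field; rewrite gt_eqF.
have cN0 : c != 0 by exact: tilt_slope_neq0.
have cuz : c ^+ 2 * ((v - 1) * z) = - c * (v - 1) * (- c * z) by ring.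
have c2 : 0 < c ^+ 2 by rewrite exprn_even_gt0.
rewrite mulrAC pmulr_lge0 ?invr_gt0 ?mulr_gt0//.
by rewrite -[RHS](pmulr_rge0 _ c2) cuz (pmulr_rge0 _ cu).
Qed.

End likelihood_statistic.

Theorem mainTheorem4 (d : measure_display) (T : measurableType d)
  (R : realType) (P0 : probability T R) (X : nat -> {RV P0 >-> R})
  (f beta gamma b l : R)
  (f_gt0 : 0 < f) (f_neq1 : f != 1)
  (beta_ge0 : 0 <= beta) (beta_lt1 : beta < 1)
  (gamma_gt0 : 0 < gamma)
  (X_gaussian : gaussian_sequence X)
  (X_stationary : stationary X)
  (X_centered : forall i : nat, ('E_P0[X i] = 0)%E)
  (X_posdef : forall m : nat, posdef_mx (cov_mx X m))
  (mean_cvg :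
     ((n%:R^-1)%:E * 'E_P0[log_lik_stat X f beta n])%E
       @[n --> within (admissible beta) \oo] --> l%:E)
  (b_gt_mean : l < b)
  (b_pos : 0 < - 2 / (1 / f ^+ 2 - 1) * (b / (1 - beta) + ln f)) :
  [/\ forall n : nat, admissible beta n ->
        (post_size beta n)%:R = n%:R * (1 - beta) /\
        forall x : 'cV[R]_(post_size beta n),
          log_lik f (cov_mx X (post_size beta n)) x =
            - (post_size beta n)%:R * ln f
            + 1 / 2 * (1 - 1 / f ^+ 2)
              * quad_form (invmx (cov_mx X (post_size beta n))) x,
      forall theta : R,
        optimizes_rate f beta b theta <->
        theta = - (1 / 2 * (1 - beta) / (b + (1 - beta) * ln f)
                   + 1 / (1 / f ^+ 2 - 1)),
      (gamma%:E = rate f beta b <->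
       gamma = (1 - beta) *
         (- (1 / 2) - 1 / (1 / f ^+ 2 - 1) * (b / (1 - beta) + ln f)
          - 1 / 2 * ln (- 2 / (1 / f ^+ 2 - 1) * (b / (1 - beta) + ln f)))) &
      gamma = (1 - beta) *
         (- (1 / 2) - 1 / (1 / f ^+ 2 - 1) * (b / (1 - beta) + ln f)
          - 1 / 2 * ln (- 2 / (1 / f ^+ 2 - 1) * (b / (1 - beta) + ln f))) ->
      ((n%:R^-1)%:E
         * lne (P0 [set w | (b <= n%:R^-1 * log_lik_stat X f beta n w)%R]))%E
        @[n --> within (admissible beta) \oo] --> (- rate f beta b)%E
      /\ (- rate f beta b = - gamma%:E)%E].
Proof.
have u0 : 0 < critical_ratio f beta b by [].
have B0 : 0 < 1 - beta by rewrite subr_gt0.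
have rE := rateE f_gt0 f_neq1 beta_lt1 u0.
have valueE : (1 - beta) *
    (- (1 / 2) - 1 / (1 / f ^+ 2 - 1) * (b / (1 - beta) + ln f)
     - 1 / 2 * ln (- 2 / (1 / f ^+ 2 - 1) * (b / (1 - beta) + ln f)))
    = (1 - beta) * chi_square_rate (critical_ratio f beta b).
  rewrite /chi_square_rate -/(tilt_slope f) -/(critical_ratio f beta b).
  have -> : 1 / tilt_slope f * (b / (1 - beta) + ln f) = - critical_ratio f beta b / 2.
    by rewrite /critical_ratio; field; rewrite tilt_slope_neq0//= gt_eqF.
  by field.
rewrite valueE; split.
- move=> n nadm; split; first exact: post_sizeE.
  by move=> x; exact: log_likE.
- exact: optimizes_rateP.
- by rewrite rE; split=> [[]|->].
move=> gammaE; rewrite rE gammaE; split; last by [].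
pose Q := post_quad_form X beta; pose u := critical_ratio f beta b.
pose m := post_size beta.
have Padm : \forall n \near within (admissible beta) \oo, admissible beta n.
  exact: near_withinT.
have Psign := mean_lt_threshold f_gt0 f_neq1 beta_ge0 beta_lt1 X_gaussian
  X_stationary X_centered X_posdef mean_cvg b_gt_mean u0.
have Pevent : \forall n \near within (admissible beta) \oo,
    P0 [set w | b <= n%:R^-1 * log_lik_stat X f beta n w]
    = P0 [set w | 0 <= (u - 1) * (Q n w - (m n)%:R * u)].
  near=> n; rewrite log_lik_eventE//; first by near: n.
  by near: n.
have mevent n : measurable [set w | 0 <= (u - 1) * (Q n w - (m n)%:R * u)].
  apply: measurable_set_ler => //; apply: measurable_funM => //.
  by apply: measurable_funB => //; exact: measurable_post_quad_form.
have mgfQ n : has_chi_square_mgf P0 (m n) (Q n).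
  exact: post_quad_form_chi_square_mgf.
have PmE : \forall n \near within (admissible beta) \oo, (m n)%:R = n%:R * (1 - beta).
  by near=> n; apply: post_sizeE => //; near: n.
apply: cvg_normalized_lne => //.
- by near=> n; rewrite (near Pevent n)// fin_num_measure.
- by near=> n; have [] : admissible beta n by near: n.
- near=> n; rewrite (near Pevent n)// mulrA -(near PmE n)//.
  rewrite -lee_fin fineK ?fin_num_measure//.
  by apply: chi_square_chernoff => //; exact: measurable_post_quad_form.
- move=> eps eps0; have [M PM] := chi_square_ldp P0 u0 eps0.
  near=> n; rewrite (near Pevent n)// mulrA -(near PmE n)//.
  apply: PM => //; last exact: measurable_post_quad_form.
  rewrite (near PmE n)// -ler_pdivrMr//; near: n.
  apply: cvg_within; exact: nbhs_infty_ger.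
Unshelve. all: by end_near. Qed.
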